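(* Let $n\ge1$ be an integer, $0\le\alpha<1$ and $\beta>1$. The $\mathcal{M}_n(\beta)$-radius of functions in $\mathcal{CS}_n(\alpha)$ is given by $$R_{\mathcal{M}_n(\beta)}(\mathcal{CS}_n(\alpha))=\left[\frac{\beta-1}{(1+n-\alpha)+\sqrt{(1+n-\alpha)^2+(\beta-1)(1+\beta-2\alpha)}}\right]^{1/n}.$$
   Context: $\mathbb{D}=\{z\in\mathbb{C}:|z|<1\}$, $\mathbb{D}_r=\{z\in\mathbb{C}:|z|<r\}$. For an integer $n\ge1$, $\mathcal{A}_n$ is the class of analytic functions on $\mathbb{D}$ of the form $f(z)=z+\sum_{k\ge n+1}a_kz^k$. $\mathcal{P}_n$ is the class of analytic functions $p(z)=1+c_nz^n+c_{n+1}z^{n+1}+\cdots$ on $\mathbb{D}$ with $\operatorname{Re}p(z)>0$ for all $z\in\mathbb{D}$. For $0\le\alpha<1$, $\mathcal{ST}_n(\alpha)$ is the class of $g\in\mathcal{A}_n$ that are starlike of order $\alpha$, i.e. $zg'(z)/g(z)$ is analytic in $\mathbb{D}$ and subordinate to $(1+(1-2\alpha)z)/(1-z)$, equivalently $\operatorname{Re}(zg'(z)/g(z))>\alpha$ in $\mathbb{D}$. $\mathcal{CS}_n(\alpha)$ (close-to-starlike functions of type $\alpha$) is the class of $f\in\mathcal{A}_n$ for which there exists $g\in\mathcal{ST}_n(\alpha)$ with $f/g\in\mathcal{P}_n$. For $\beta>1$, $\mathcal{M}_n(\beta)$ is the class of $f\in\mathcal{A}_n$ with $\operatorname{Re}\left(zf'(z)/f(z)\right)<\beta$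 for all $z\in\mathbb{D}$ (with $zf'(z)/f(z)$ taken to be $1$ at $z=0$). For a class $\mathcal{M}\subset\mathcal{A}_n$, the $\mathcal{M}_n(\beta)$-radius $R_{\mathcal{M}_n(\beta)}(\mathcal{M})$ is the largest number $R\in(0,1]$ such that for every $f\in\mathcal{M}$ and every $r<R$ one has $\operatorname{Re}\left(zf'(z)/f(z)\right)<\beta$ for all $z\in\mathbb{D}_r$. *)

(* Defs.v *)
From Stdlib Require Export Reals.
From Coquelicot Require Export Coquelicot.

Local Open Scope C_scope.

(* Functions on the unit disk are total functions C -> C of which only the
   values on [Cmod z < 1] matter. *)

Definition analytic_on_disk (f : C -> C) : Prop :=
  forall z : C, Cmod z < 1 -> @ex_derive C_AbsRing C_NormedModule f z.

Definition classA (n : nat) (f : C -> C) : Prop :=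
  analytic_on_disk f /\
  exists a : nat -> C,
    (forall k : nat, (k <= n)%nat -> a k = 0) /\
    forall z : C, Cmod z < 1 ->
      @is_pseries C_AbsRing C_NormedModule a z (f z - z).

Definition classP (n : nat) (p : C -> C) : Prop :=
  analytic_on_disk p /\
  (exists c : nat -> C,
    (forall k : nat, (k < n)%nat -> c k = 0) /\
    forall z : C, Cmod z < 1 ->
      @is_pseries C_AbsRing C_NormedModule c z (p z - 1)) /\
  forall z : C, Cmod z < 1 -> (0 < Re (p z))%R.

Definition subordinate (f h : C -> C) : Prop :=
  exists w : C -> C,
    analytic_on_disk w /\ w 0 = 0 /\
    forall z : C, Cmod z < 1 -> Cmod (w z) < 1 /\ f z = h (w z).

(* For f, g normalised by f(z) = z + ..., both z f'(z) / f(z) and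
   f(z) / g(z) have a removable singularity at 0 with value 1. *)
Definition one_at_0 (h : C -> C) (z : C) : C :=
  if Ceq_dec z 0 then 1 else h z.

(* [C_derive] is the complex derivative only where it exists, which is the case
   on the disk for the analytic functions considered here. *)
Definition zlogder (f : C -> C) : C -> C :=
  one_at_0 (fun z => z * C_derive f z / f z).

(* Division in C is total, so that the quotients are only meaningful under this
   condition. *)
Definition nonvanishing (r : R) (f : C -> C) : Prop :=
  forall z : C, Cmod z < r -> z <> 0 -> f z <> 0.

Definition classST (n : nat) (alpha : R) (g : C -> C) : Prop :=
  classA n g /\ nonvanishing 1 g /\
  analytic_on_disk (zlogder g) /\
  subordinate (zlogder g)
    (fun z => (1 + RtoC (1 - 2 * alpha)%R * z) / (1 - z)).

Definition classCS (n : nat) (alpha : R) (f : C -> C) : Prop :=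
  classA n f /\
  exists g : C -> C,
    classST n alpha g /\ classP n (one_at_0 (fun z => f z / g z)).

(* The condition defining the class M_n(beta), restricted to the disk of
   radius r; on the unit disk it cuts M_n(beta) out of [classA n]. *)
Definition M_condition (beta r : R) (f : C -> C) : Prop :=
  nonvanishing r f /\
  forall z : C, Cmod z < r -> (Re (zlogder f z) < beta)%R.

Definition classM (n : nat) (beta : R) (f : C -> C) : Prop :=
  classA n f /\ M_condition beta 1 f.

Definition M_admissible (beta : R) (F : (C -> C) -> Prop) (rho : R) : Prop :=
  (0 < rho <= 1)%R /\
  forall f : C -> C, F f ->
    forall r : R, (r < rho)%R -> M_condition beta r f.

Definition is_M_radius (beta : R) (F : (C -> C) -> Prop) (rho : R) : Prop :=
  M_admissible beta F rho /\
  forall rho' : R, M_admissible beta F rho' -> (rho' <= rho)%R.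

(* Main.v *)
Require Import Defs.
From Stdlib Require Import Reals Lra Lia ClassicalEpsilon.
From Coquelicot Require Import Coquelicot.

Local Open Scope R_scope.

(** Write [f = g p] with [g] starlike of order [alpha] and [p] of positive
    real part.  Then [z f'/f = z g'/g + z p'/p], and the two summands are
    bounded separately in terms of [rho = |z|^n].

    The subordination of [z g'/g] to the half-plane map of order [alpha] is
    through a function [w] bounded by [1]; as [g(z) = z + O(z^(n+1))], [w]
    vanishes to order [n] and Schwarz's lemma gives [|w| <= rho], whence
    [Re (z g'/g) <= (1 + (1 - 2 alpha) rho) / (1 - rho)]
    ([starlike_estimate]).  Likewise [(p - 1) / (p + 1) = z^n phi] with
    [|phi| <= 1], and the Schwarz-Pick inequality for [phi] gives
    [|z p'/p| <= 2 n rho / (1 - rho^2)] ([positive_real_part_der]).  The sum of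
    the two bounds is less than [beta] exactly when [rho] is below the
    positive root of a quadratic equation ([critical_rho_root]), which is
    the [n]-th power of the claimed radius.

    Both bounds are attained at positive [z] by
    [f = z (1 + z^n) (1 - z^n)^(-delta)] with
    [delta = 1 + 2 (1 - alpha) / n] ([extremal_classCS],
    [extremal_attains_majorant]), so no larger radius is admissible.

    No integral formula is used for the two Schwarz lemmas.  All functions
    to which they are applied are quotients of power series convergent on
    the whole disk, hence have Taylor expansions of every order at every
    point ([PS_taylor], [taylor_inv]).  For functions with an expansion of
    order three the maximum principle ([max_principle]) follows by comparing
    the value of [|F|^2 + eps |z|^2] at a point with its mean over four
    neighbouring points. *)

(** * Divided differences and complex derivatives *)

Definition near (z : C) (P : C -> Prop) : Prop :=
  exists d : R, 0 < d /\ forall y : C, Cmod (y - z) < d -> P y.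

Lemma near_and (z : C) (P Q : C -> Prop) :
  near z P -> near z Q -> near z (fun y => P y /\ Q y).
Proof.
  intros [d [Hd HP]] [e [He HQ]].
  exists (Rmin d e). split; [apply Rmin_pos; assumption|].
  intros y Hy. split.
  - apply HP. eapply Rlt_le_trans; [exact Hy|apply Rmin_l].
  - apply HQ. eapply Rlt_le_trans; [exact Hy|apply Rmin_r].
Qed.

Lemma near_mono (z : C) (P Q : C -> Prop) :
  (forall y, P y -> Q y) -> near z P -> near z Q.
Proof. intros H [d [Hd HP]]. exists d. split; auto. Qed.

Lemma near_at (z : C) (P : C -> Prop) : near z P -> P z.
Proof.
  intros [d [Hd HP]]. apply HP.
  replace (z - z)%C with (RtoC 0) by ring. rewrite Cmod_0. exact Hd.
Qed.

Lemma near_disk (s : R) (z : C) : Cmod z < s -> near z (fun y => Cmod y < s).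
Proof.
  intros Hz. exists (s - Cmod z). split; [lra|]. intros y Hy.
  replace y with ((y - z) + z)%C by ring.
  eapply Rle_lt_trans; [apply Cmod_triangle|lra].
Qed.

Lemma near_neq (z w : C) : z <> w -> near z (fun y => y <> w).
Proof.
  intros Hz. exists (Cmod (w - z)). split.
  - apply Cmod_gt_0. intros H. apply Hz.
    replace z with (w - (w - z))%C by ring. rewrite H. ring.
  - intros y Hy E. subst y. lra.
Qed.

(** A Taylor expansion at [z] of degree less than [m] with remainder
    [O((y - z)^m)].  It is encoded by iterated divided differences instead of
    coefficients: products, inverses and the removal of a zero are then
    handled by induction on [m], without any bookkeeping of coefficients. *)
Fixpoint taylor (m : nat) (f : C -> C) (z : C) : Prop :=
  match m with
  | O => exists M : R, near z (fun y => Cmod (f y) <= M)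
  | S m' => exists f1 : C -> C, taylor m' f1 z /\
              near z (fun y => f y = (f z + (y - z) * f1 y)%C)
  end.

Lemma taylor_ext (m : nat) (f g : C -> C) (z : C) :
  near z (fun y => f y = g y) -> taylor m f z -> taylor m g z.
Proof.
  intros E. destruct m as [|m]; simpl.
  - intros [M HM]. exists M. generalize (near_and _ _ _ E HM).
    apply near_mono. intros y [<- H]. exact H.
  - intros [f1 [T H]]. exists f1. split; [exact T|].
    generalize (near_and _ _ _ E H). apply near_mono.
    intros y [<- H']. rewrite H'. rewrite (near_at _ _ E). reflexivity.
Qed.

Lemma taylor_1_bounded (f : C -> C) (z : C) : taylor 1 f z -> taylor 0 f z.
Proof.
  simpl. intros [f1 [[M HM] H]].
  exists (Cmod (f z) + M). destruct (near_and _ _ _ HM H) as [d [Hd H']].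
  exists (Rmin d 1). split; [apply Rmin_pos; lra|].
  intros y Hy.
  assert (Hyd : Cmod (y - z) < d) by
    (eapply Rlt_le_trans; [exact Hy|apply Rmin_l]).
  assert (Hy1 : Cmod (y - z) < 1) by
    (eapply Rlt_le_trans; [exact Hy|apply Rmin_r]).
  destruct (H' y Hyd) as [Hb ->].
  eapply Rle_trans; [apply Cmod_triangle|]. rewrite Cmod_mult.
  assert (0 <= Cmod (y - z)) by apply Cmod_ge_0.
  assert (0 <= Cmod (f1 y)) by apply Cmod_ge_0. nra.
Qed.

Lemma taylor_pred (m : nat) (f : C -> C) (z : C) :
  taylor (S m) f z -> taylor m f z.
Proof.
  revert f. induction m as [|m IH]; intros f.
  - apply taylor_1_bounded.
  - intros [f1 [T H]]. exists f1. split; [apply IH; exact T|exact H].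
Qed.

Lemma taylor_le (m k : nat) (f : C -> C) (z : C) :
  (m <= k)%nat -> taylor k f z -> taylor m f z.
Proof. intros H. induction H; auto. intros T. apply IHle, taylor_pred, T. Qed.

Lemma taylor_const (m : nat) (c z : C) : taylor m (fun _ => c) z.
Proof.
  revert c. induction m as [|m IH]; intros c; simpl.
  - exists (Cmod c). exists 1. split; [lra|]. intros; lra.
  - exists (fun _ => RtoC 0). split; [apply IH|].
    exists 1. split; [lra|]. intros; ring.
Qed.

Lemma taylor_id (m : nat) (z : C) : taylor m (fun y => y) z.
Proof.
  destruct m as [|m].
  - exists (Cmod z + 1). exists 1. split; [lra|]. intros y Hy.
    replace y with (z + (y - z))%C by ring.
    eapply Rle_trans; [apply Cmod_triangle|lra].
  - exists (fun _ => RtoC 1). split; [apply taylor_const|].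
    exists 1. split; [lra|]. intros; ring.
Qed.

Lemma taylor_plus (m : nat) (f g : C -> C) (z : C) :
  taylor m f z -> taylor m g z -> taylor m (fun y => (f y + g y)%C) z.
Proof.
  revert f g. induction m as [|m IH]; intros f g.
  - intros [M HM] [N HN]. exists (M + N).
    generalize (near_and _ _ _ HM HN). apply near_mono. intros y [H1 H2].
    eapply Rle_trans; [apply Cmod_triangle|lra].
  - intros [f1 [T1 H1]] [g1 [T2 H2]]. exists (fun y => (f1 y + g1 y)%C).
    split; [apply IH; assumption|].
    generalize (near_and _ _ _ H1 H2). apply near_mono. intros y [E1 E2].
    rewrite E1, E2. ring.
Qed.

Lemma taylor_mult (m : nat) (f g : C -> C) (z : C) :
  taylor m f z -> taylor m g z -> taylor m (fun y => (f y * g y)%C) z.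
Proof.
  revert f g. induction m as [|m IH]; intros f g.
  - intros [M HM] [N HN]. exists (M * N).
    generalize (near_and _ _ _ HM HN). apply near_mono. intros y [H1 H2].
    rewrite Cmod_mult. apply Rmult_le_compat; auto using Cmod_ge_0.
  - intros Tf Tg. assert (Tg' := taylor_pred _ _ _ Tg).
    destruct Tf as [f1 [T1 H1]]. destruct Tg as [g1 [T2 H2]].
    exists (fun y => (f1 y * g y + f z * g1 y)%C). split.
    + apply taylor_plus; [apply IH; assumption|].
      apply IH; [apply taylor_const|assumption].
    + generalize (near_and _ _ _ H1 H2). apply near_mono. intros y [E1 E2].
      rewrite E1, E2 at 1. rewrite E2. ring.
Qed.

Lemma taylor_1_continuous (f : C -> C) (z : C) (eps : R) :
  taylor 1 f z -> 0 < eps -> near z (fun y => Cmod (f y - f z) < eps).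
Proof.
  intros [f1 [[M HM] H]] He.
  destruct (near_and _ _ _ HM H) as [d [Hd H']].
  assert (HM0 : 0 <= M).
  { eapply Rle_trans; [apply Cmod_ge_0|]. apply (near_at _ _ HM). }
  exists (Rmin d (eps / (M + 1))). split.
  - apply Rmin_pos; [assumption|]. apply Rdiv_lt_0_compat; lra.
  - intros y Hy.
    assert (Hyd : Cmod (y - z) < d) by
      (eapply Rlt_le_trans; [exact Hy|apply Rmin_l]).
    assert (Hy1 : Cmod (y - z) < eps / (M + 1)) by
      (eapply Rlt_le_trans; [exact Hy|apply Rmin_r]).
    destruct (H' y Hyd) as [Hb ->].
    replace (f z + (y - z) * f1 y - f z)%C with ((y - z) * f1 y)%C by ring.
    rewrite Cmod_mult.
    apply (Rmult_lt_compat_r (M + 1)) in Hy1; [|lra].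
    replace (eps / (M + 1) * (M + 1)) with eps in Hy1 by (field; lra).
    assert (0 <= Cmod (y - z)) by apply Cmod_ge_0.
    assert (0 <= Cmod (f1 y)) by apply Cmod_ge_0. nra.
Qed.

Lemma Cmod_minus_sym (x y : C) : Cmod (x - y) = Cmod (y - x).
Proof. rewrite <- Cmod_opp. f_equal. ring. Qed.

Lemma taylor_1_nonzero (f : C -> C) (z : C) :
  taylor 1 f z -> f z <> 0%C ->
  near z (fun y => Cmod (f z) / 2 <= Cmod (f y)).
Proof.
  intros T Hz. apply Cmod_gt_0 in Hz.
  assert (He : 0 < Cmod (f z) / 2) by lra.
  generalize (taylor_1_continuous f z _ T He). apply near_mono.
  intros y Hy.
  assert (Cmod (f z) <= Cmod (f y) + Cmod (f y - f z)).
  { rewrite Cmod_minus_sym.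
    replace (f z) with (f y + (f z - f y))%C at 1 by ring.
    apply Cmod_triangle. }
  lra.
Qed.

Lemma taylor_inv (m : nat) (f : C -> C) (z : C) :
  taylor (S m) f z -> f z <> 0%C -> taylor (S m) (fun y => (/ f y)%C) z.
Proof.
  revert f. induction m as [|m IH]; intros f T Hz;
    assert (Hnz : near z (fun y => Cmod (f z) / 2 <= Cmod (f y)))
      by (apply taylor_1_nonzero; [apply (taylor_le 1 _ f z) in T; [exact T|lia]|exact Hz]);
    assert (Hz' := proj1 (Cmod_gt_0 _) Hz);
    assert (Heq : forall f1, near z (fun y => f y = (f z + (y - z) * f1 y)%C) ->
       near z (fun y => (/ f y)%C =
         (/ f z + (y - z) * (- / f z * (f1 y * / f y)))%C)).
  1,3: intros f1 H1; generalize (near_and _ _ _ Hnz H1); apply near_mono;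
    intros y [Hy E];
    assert (f y <> 0%C) by (apply Cmod_gt_0; lra);
    assert (E' : ((y - z) * f1 y = f y - f z)%C) by (rewrite E; ring);
    transitivity (/ f z - / f z * ((y - z) * f1 y) * / f y)%C;
      [rewrite E'; field; auto | ring].
  - destruct T as [f1 [T1 H1]].
    exists (fun y => (- / f z * (f1 y * / f y))%C). split; [|auto].
    apply taylor_mult; [apply taylor_const|]. apply taylor_mult; [exact T1|].
    exists (/ (Cmod (f z) / 2)). revert Hnz. apply near_mono. intros y Hy.
    rewrite Cmod_inv; [|apply Cmod_gt_0; lra].
    apply Rinv_le_contravar; lra.
  - assert (T' := taylor_pred _ _ _ T). destruct T as [f1 [T1 H1]].
    exists (fun y => (- / f z * (f1 y * / f y))%C). split; [|auto].
    apply taylor_mult; [apply taylor_const|]. apply taylor_mult; [exact T1|].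
    apply IH; assumption.
Qed.

Lemma taylor_minus (m : nat) (f g : C -> C) (z : C) :
  taylor m f z -> taylor m g z -> taylor m (fun y => (f y - g y)%C) z.
Proof.
  intros Tf Tg.
  apply (taylor_ext m (fun y => (f y + (- (1)) * g y)%C)).
  - exists 1. split; [lra|]. intros; ring.
  - apply taylor_plus; [exact Tf|]. apply taylor_mult; [apply taylor_const|exact Tg].
Qed.

Lemma taylor_pow (m n : nat) (f : C -> C) (z : C) :
  taylor m f z -> taylor m (fun y => (f y ^ n)%C) z.
Proof.
  intros T. induction n as [|n IH]; simpl.
  - apply taylor_const.
  - apply taylor_mult; assumption.
Qed.

(** Carathéodory's form of the derivative, with a divided difference that is
    Lipschitz at [z] instead of merely continuous, so that it is exactly what
    [taylor 2] provides. *)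
Definition has_der (f : C -> C) (z d : C) : Prop :=
  exists f1 : C -> C, taylor 1 f1 z /\ f1 z = d /\
    near z (fun y => f y = (f z + (y - z) * f1 y)%C).

Lemma has_der_ex (f : C -> C) (z : C) :
  taylor 2 f z -> exists d, has_der f z d.
Proof. intros [f1 [T H]]. exists (f1 z), f1. auto. Qed.

Lemma has_der_taylor (f : C -> C) (z d : C) : has_der f z d -> taylor 2 f z.
Proof. intros [f1 [T [_ H]]]. exists f1. auto. Qed.

Lemma has_der_is_derive (f : C -> C) (z d : C) :
  has_der f z d -> @is_derive C_AbsRing C_NormedModule f z d.
Proof.
  intros [f1 [T [Ed H]]]. split; [apply is_linear_scal_l|].
  intros x Hx.
  assert (x = z).
  { symmetry.
    apply (is_filter_lim_locally_unique (V := AbsRing_NormedModule C_AbsRing)).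
    exact Hx. }
  subst x. clear Hx. intros eps.
  destruct (near_and _ _ _ H (taylor_1_continuous f1 z eps T (cond_pos eps)))
    as [e [He HE]].
  exists (mkposreal e He). intros y Hy.
  change (Cmod (y - z) < e) in Hy.
  destruct (HE y Hy) as [E1 E2].
  change (Cmod (f y - f z - (y - z) * d) <= eps * Cmod (y - z)).
  rewrite E1, <- Ed.
  replace (f z + (y - z) * f1 y - f z - (y - z) * f1 z)%C
    with ((f1 y - f1 z) * (y - z))%C by ring.
  rewrite Cmod_mult. apply Rmult_le_compat_r; [apply Cmod_ge_0|lra].
Qed.

Lemma has_der_C_derive (f : C -> C) (z d : C) :
  has_der f z d -> C_derive f z = d.
Proof. intros H. apply is_C_derive_unique. apply has_der_is_derive, H. Qed.

Lemma taylor_ex_derive (f : C -> C) (z : C) :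
  taylor 2 f z -> @ex_derive C_AbsRing C_NormedModule f z.
Proof.
  intros T. destruct (has_der_ex f z T) as [d H].
  exists d. apply has_der_is_derive, H.
Qed.

Lemma has_der_unique (f : C -> C) (z d e : C) :
  has_der f z d -> has_der f z e -> d = e.
Proof.
  intros H1 H2. rewrite <- (has_der_C_derive _ _ _ H1). apply has_der_C_derive, H2.
Qed.

Lemma has_der_ext (f g : C -> C) (z d : C) :
  near z (fun y => f y = g y) -> has_der f z d -> has_der g z d.
Proof.
  intros E [f1 [T [Ed H]]]. exists f1. repeat split; try assumption.
  generalize (near_and _ _ _ E H). apply near_mono.
  intros y [<- ->]. rewrite (near_at _ _ E). reflexivity.
Qed.

Lemma has_der_const (c z : C) : has_der (fun _ => c) z 0.
Proof.
  exists (fun _ => RtoC 0). repeat split; [apply taylor_const|].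
  exists 1. split; [lra|]. intros; ring.
Qed.

Lemma has_der_id (z : C) : has_der (fun y => y) z 1.
Proof.
  exists (fun _ => RtoC 1). repeat split; [apply taylor_const|].
  exists 1. split; [lra|]. intros; ring.
Qed.

Lemma has_der_plus (f g : C -> C) (z d e : C) :
  has_der f z d -> has_der g z e -> has_der (fun y => (f y + g y)%C) z (d + e).
Proof.
  intros [f1 [T1 [E1 H1]]] [g1 [T2 [E2 H2]]].
  exists (fun y => (f1 y + g1 y)%C).
  repeat split; [apply taylor_plus; assumption|congruence|].
  generalize (near_and _ _ _ H1 H2). apply near_mono. intros y [-> ->]. ring.
Qed.

Lemma has_der_mult (f g : C -> C) (z d e : C) :
  has_der f z d -> has_der g z e ->
  has_der (fun y => (f y * g y)%C) z (d * g z + f z * e).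
Proof.
  intros Df Dg. assert (Tg := taylor_pred _ _ _ (has_der_taylor _ _ _ Dg)).
  destruct Df as [f1 [T1 [E1 H1]]]. destruct Dg as [g1 [T2 [E2 H2]]].
  exists (fun y => (f1 y * g y + f z * g1 y)%C).
  repeat split.
  - apply taylor_plus; apply taylor_mult; try assumption. apply taylor_const.
  - congruence.
  - generalize (near_and _ _ _ H1 H2). apply near_mono. intros y [E E'].
    rewrite E, E' at 1. rewrite E'. ring.
Qed.

Lemma has_der_pow (f : C -> C) (z d : C) (n : nat) :
  has_der f z d ->
  has_der (fun y => (f y ^ n)%C) z (INR n * f z ^ (n - 1) * d).
Proof.
  intros H. induction n as [|n IH].
  - simpl. replace (0 * 1 * d)%C with (RtoC 0) by ring. apply has_der_const.
  - replace (INR (S n) * f z ^ (S n - 1) * d)%C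
      with (d * f z ^ n + f z * (INR n * f z ^ (n - 1) * d))%C.
    + exact (has_der_mult f (fun y => (f y ^ n)%C) z _ _ H IH).
    + rewrite S_INR, RtoC_plus. replace (S n - 1)%nat with n by lia.
      destruct n as [|n]; [simpl; ring|].
      replace (S n - 1)%nat with n by lia. simpl. ring.
Qed.

(** * Complex power series on the unit disk *)

Lemma sum_n_C (u : nat -> C) (n : nat) :
  sum_n u n = (sum_n (fun k => Re (u k)) n, sum_n (fun k => Im (u k)) n).
Proof.
  induction n as [|n IH].
  - rewrite !sum_O. destruct (u 0%nat); reflexivity.
  - rewrite !sum_Sn, IH. destruct (u (S n)); reflexivity.
Qed.

Lemma is_series_C_iff (u : nat -> C) (l : C) :
  @is_series C_AbsRing C_NormedModule u l <->
  forall eps, 0 < eps -> exists N, forall n, (N <= n)%nat ->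
    Cmod (sum_n u n - l) < eps.
Proof.
  split.
  - intros H eps He.
    assert (L : @locally C_NormedModule l (fun y : C => Cmod (y - l) < eps)).
    { apply (locally_le_locally_norm (V := C_NormedModule)).
      exists (mkposreal eps He). intros y Hy. exact Hy. }
    destruct (H _ L) as [N HN]. exists N. exact HN.
  - intros H P [e He]. destruct (H e (cond_pos e)) as [N HN].
    exists N. intros n Hn. apply He. apply C_NormedModule_mixin_compat1.
    apply HN, Hn.
Qed.

Lemma is_series_C_unique (u : nat -> C) (l l' : C) :
  @is_series C_AbsRing C_NormedModule u l ->
  @is_series C_AbsRing C_NormedModule u l' -> l = l'.
Proof.
  intros H H'.
  exact (filterlim_locally_unique (V := C_NormedModule) (sum_n u) l l' H H').
Qed.

Lemma is_series_C_eq (u : nat -> C) (l l' : C) :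
  @is_series C_AbsRing C_NormedModule u l -> l = l' ->
  @is_series C_AbsRing C_NormedModule u l'.
Proof. intros H <-. exact H. Qed.

Lemma is_series_C_bound (u : nat -> C) (l : C) (M : R) :
  @is_series C_AbsRing C_NormedModule u l ->
  (forall n, Cmod (sum_n u n) <= M) -> Cmod l <= M.
Proof.
  intros H HM. apply Rnot_lt_le. intros Hl.
  rewrite is_series_C_iff in H.
  destruct (H (Cmod l - M)) as [N HN]; [lra|].
  specialize (HN N (le_n N)). specialize (HM N).
  assert (Cmod l <= Cmod (sum_n u N) + Cmod (sum_n u N - l)).
  { rewrite Cmod_minus_sym.
    replace l with (sum_n u N + (l - sum_n u N))%C at 1 by ring.
    apply Cmod_triangle. }
  lra.
Qed.

Lemma is_series_C_bounded_terms (u : nat -> C) (l : C) :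
  @is_series C_AbsRing C_NormedModule u l ->
  exists M, forall n, Cmod (u n) <= M.
Proof.
  intros H. rewrite is_series_C_iff in H.
  destruct (H 1 Rlt_0_1) as [N HN].
  assert (B : forall m, exists M, forall n, (n < m)%nat -> Cmod (u n) <= M).
  { induction m as [|m [M HM]].
    - exists 0. intros; lia.
    - exists (Rmax M (Cmod (u m))). intros n Hn.
      destruct (Nat.eq_dec n m) as [->|Hne]; [apply Rmax_r|].
      eapply Rle_trans; [apply HM; lia|apply Rmax_l]. }
  destruct (B (S N)) as [M HM]. exists (Rmax M 2). intros n.
  destruct (Nat.le_gt_cases n N) as [Hn|Hn].
  - eapply Rle_trans; [apply HM; lia|apply Rmax_l].
  - eapply Rle_trans; [|apply Rmax_r]. destruct n as [|n]; [lia|].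
    assert (H1 := HN n ltac:(lia)). assert (H2 := HN (S n) ltac:(lia)).
    rewrite sum_Sn in H2.
    change (Cmod (sum_n u n + u (S n) - l) < 1) in H2.
    replace (u (S n)) with
      ((sum_n u n + u (S n) - l) + (- (sum_n u n - l)))%C by ring.
    eapply Rle_trans; [apply Cmod_triangle|]. rewrite Cmod_opp. lra.
Qed.

Definition Cseries (u : nat -> C) : C :=
  (Series (fun k => Re (u k)), Series (fun k => Im (u k))).

Lemma Cmod_le_abs (x y : R) : Cmod (x, y) <= Rabs x + Rabs y.
Proof.
  replace (x, y) with (RtoC x + Ci * RtoC y)%C
    by (unfold RtoC, Ci, Cplus, Cmult; simpl; f_equal; ring).
  eapply Rle_trans; [apply Cmod_triangle|].
  rewrite Cmod_mult, Cmod_Ci, !Cmod_R. lra.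
Qed.

Lemma Im_le_Cmod (c : C) : Rabs (Im c) <= Cmod c.
Proof. eapply Rle_trans; [|apply Rmax_Cmod]. apply Rmax_r. Qed.

Lemma Cseries_correct (u : nat -> C) :
  ex_series (fun k => Cmod (u k)) ->
  @is_series C_AbsRing C_NormedModule u (Cseries u).
Proof.
  intros H.
  assert (Hr : is_series (fun k => Re (u k)) (Series (fun k => Re (u k)))).
  { apply Series_correct.
    apply (ex_series_le (V := R_CompleteNormedModule) _ (fun k => Cmod (u k))); [|exact H].
    intros k. apply re_le_Cmod. }
  assert (Hi : is_series (fun k => Im (u k)) (Series (fun k => Im (u k)))).
  { apply Series_correct.
    apply (ex_series_le (V := R_CompleteNormedModule) _ (fun k => Cmod (u k))); [|exact H].
    intros k. apply Im_le_Cmod. }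
  apply is_series_C_iff. intros eps He.
  assert (He2 : 0 < eps / 2) by lra.
  assert (Hr' := proj1 (filterlim_locally (U := R_UniformSpace) _ _) Hr (mkposreal _ He2)).
  assert (Hi' := proj1 (filterlim_locally (U := R_UniformSpace) _ _) Hi (mkposreal _ He2)).
  destruct Hr' as [N1 H1]. destruct Hi' as [N2 H2].
  exists (max N1 N2). intros n Hn.
  specialize (H1 n ltac:(lia)). specialize (H2 n ltac:(lia)).
  rewrite sum_n_C.
  change (Rabs (sum_n (fun k => Re (u k)) n - Series (fun k => Re (u k))) < eps / 2) in H1.
  change (Rabs (sum_n (fun k => Im (u k)) n - Series (fun k => Im (u k))) < eps / 2) in H2.
  unfold Cseries.
  eapply Rle_lt_trans; [apply Cmod_le_abs|]. simpl. unfold Rminus in H1, H2. lra.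
Qed.

Lemma Cseries_unique (u : nat -> C) (l : C) :
  ex_series (fun k => Cmod (u k)) ->
  @is_series C_AbsRing C_NormedModule u l -> l = Cseries u.
Proof. intros H L. eapply is_series_C_unique; [exact L|apply Cseries_correct, H]. Qed.

(** Cauchy's estimate for a radius of convergence at least [1].  It is
    stable under all the operations on coefficients used here and, by
    comparison with a geometric series, gives absolute convergence. *)
Definition geom_bounded (a : nat -> C) : Prop :=
  forall rho, 0 < rho < 1 -> exists M, forall k, Cmod (a k) * rho ^ k <= M.

Lemma geom_bounded_pos (a : nat -> C) (rho : R) : geom_bounded a -> 0 < rho < 1 ->
  exists M, 0 <= M /\ forall k, Cmod (a k) * rho ^ k <= M.
Proof.
  intros H Hr. destruct (H rho Hr) as [M HM]. exists M. split; [|exact HM].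
  eapply Rle_trans; [|apply (HM 0%nat)].
  apply Rmult_le_pos; [apply Cmod_ge_0|simpl; lra].
Qed.

Lemma geom_bounded_ex_series (a : nat -> C) (rho : R) :
  geom_bounded a -> 0 <= rho < 1 -> ex_series (fun k => Cmod (a k) * rho ^ k).
Proof.
  intros H Hr.
  set (s := (1 + rho) / 2). assert (Hs : rho < s < 1) by (unfold s; lra).
  destruct (geom_bounded_pos a s H) as [M [HM0 HM]]; [lra|].
  apply (ex_series_le (V := R_CompleteNormedModule) _ (fun k => scal M ((rho / s) ^ k))).
  - intros k. change (Rabs (Cmod (a k) * rho ^ k) <= M * (rho / s) ^ k).
    assert (0 <= (rho / s) ^ k).
    { apply pow_le. apply Rmult_le_pos; [lra|]. left. apply Rinv_0_lt_compat. lra. }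
    rewrite Rabs_pos_eq.
    + replace (rho ^ k) with (s ^ k * (rho / s) ^ k)
        by (rewrite <- Rpow_mult_distr; f_equal; field; lra).
      rewrite <- Rmult_assoc. apply Rmult_le_compat_r; auto.
    + apply Rmult_le_pos; [apply Cmod_ge_0|apply pow_le; lra].
  - apply (ex_series_scal_l (V := R_NormedModule)). apply ex_series_geom.
    rewrite Rabs_pos_eq.
    + apply Rmult_lt_reg_r with s; [lra|]. unfold Rdiv. rewrite Rmult_assoc, Rinv_l; lra.
    + apply Rmult_le_pos; [lra|]. left. apply Rinv_0_lt_compat. lra.
Qed.

Definition PS (a : nat -> C) (z : C) : C := Cseries (fun k => (a k * z ^ k)%C).

Lemma ex_series_PS (a : nat -> C) (z : C) : geom_bounded a -> Cmod z < 1 ->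
  ex_series (fun k => Cmod (a k * z ^ k)).
Proof.
  intros H Hz. eapply ex_series_ext; [|apply (geom_bounded_ex_series a (Cmod z) H)].
  - intros k. simpl. rewrite Cmod_mult, Cmod_pow. reflexivity.
  - split; [apply Cmod_ge_0|exact Hz].
Qed.

Lemma PS_correct (a : nat -> C) (z : C) : geom_bounded a -> Cmod z < 1 ->
  @is_series C_AbsRing C_NormedModule (fun k => (a k * z ^ k)%C) (PS a z).
Proof. intros H Hz. apply Cseries_correct, ex_series_PS; assumption. Qed.

Lemma PS_unique (a : nat -> C) (z l : C) : geom_bounded a -> Cmod z < 1 ->
  @is_series C_AbsRing C_NormedModule (fun k => (a k * z ^ k)%C) l -> l = PS a z.
Proof. intros H Hz. apply Cseries_unique, ex_series_PS; assumption. Qed.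

Lemma is_pseries_C (a : nat -> C) (z l : C) :
  @is_pseries C_AbsRing C_NormedModule a z l <->
  @is_series C_AbsRing C_NormedModule (fun k => (a k * z ^ k)%C) l.
Proof.
  unfold is_pseries.
  assert (E : forall k, (a k * z ^ k)%C =
    @scal C_AbsRing C_NormedModule (pow_n (K := C_AbsRing) z k) (a k)).
  { intros k. change (a k * z ^ k = z ^ k * a k)%C. ring. }
  split; apply is_series_ext; intros k; [symmetry|]; apply E.
Qed.

Lemma PS_is_pseries (a : nat -> C) (z : C) : geom_bounded a -> Cmod z < 1 ->
  @is_pseries C_AbsRing C_NormedModule a z (PS a z).
Proof. intros H Hz. apply is_pseries_C, PS_correct; assumption. Qed.

(** This turns the expansions in the definitions of the function classes
    into the total operation [PS]. *)
Lemma pseries_geom_bounded (a : nat -> C) (h : C -> C) :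
  (forall z, Cmod z < 1 -> @is_pseries C_AbsRing C_NormedModule a z (h z)) ->
  geom_bounded a /\ forall z, Cmod z < 1 -> h z = PS a z.
Proof.
  intros H.
  assert (B : geom_bounded a).
  { intros rho Hr.
    assert (Hz : Cmod (RtoC rho) < 1) by (rewrite Cmod_R, Rabs_pos_eq; lra).
    specialize (H _ Hz). apply (proj1 (is_pseries_C a rho (h rho))) in H.
    destruct (is_series_C_bounded_terms _ _ H) as [M HM]. exists M. intros k.
    specialize (HM k). rewrite Cmod_mult, Cmod_pow, Cmod_R, Rabs_pos_eq in HM; lra. }
  split; [exact B|]. intros z Hz. apply PS_unique; [exact B|exact Hz|].
  exact (proj1 (is_pseries_C a z (h z)) (H z Hz)).
Qed.

Lemma geom_bounded_plus (a b : nat -> C) : geom_bounded a -> geom_bounded b ->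
  geom_bounded (fun k => (a k + b k)%C).
Proof.
  intros Ha Hb rho Hr. destruct (Ha rho Hr) as [M HM]. destruct (Hb rho Hr) as [N HN].
  exists (M + N). intros k. specialize (HM k). specialize (HN k).
  assert (0 <= rho ^ k) by (apply pow_le; lra).
  assert (H1 := Cmod_triangle (a k) (b k)). nra.
Qed.

Lemma geom_bounded_scal (c : C) (a : nat -> C) : geom_bounded a ->
  geom_bounded (fun k => (c * a k)%C).
Proof.
  intros Ha rho Hr. destruct (Ha rho Hr) as [M HM].
  exists (Cmod c * M). intros k. rewrite Cmod_mult, Rmult_assoc.
  apply Rmult_le_compat_l; [apply Cmod_ge_0|apply HM].
Qed.

Lemma geom_bounded_S (a : nat -> C) : geom_bounded a ->
  geom_bounded (fun k => a (S k)).
Proof.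
  intros Ha rho Hr. destruct (Ha rho Hr) as [M HM].
  exists (M / rho). intros k. specialize (HM (S k)). simpl in HM.
  apply Rmult_le_reg_r with rho; [lra|].
  replace (M / rho * rho) with M by (field; lra). lra.
Qed.

Lemma geom_bounded_shift (a : nat -> C) (n : nat) : geom_bounded a ->
  geom_bounded (fun k => a (k + n)%nat).
Proof.
  intros Ha. induction n as [|n IH].
  - intros rho Hr. destruct (Ha rho Hr) as [M HM]. exists M.
    intros k. rewrite Nat.add_0_r. apply HM.
  - apply geom_bounded_S in IH. intros rho Hr. destruct (IH rho Hr) as [M HM].
    exists M. intros k. rewrite <- Nat.add_succ_comm. apply HM.
Qed.

Lemma geom_bounded_INR (a : nat -> C) : geom_bounded a ->
  geom_bounded (fun k => (INR k * a k)%C).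
Proof.
  intros Ha rho Hr.
  set (s := (1 + rho) / 2). assert (Hs : rho < s < 1) by (unfold s; lra).
  destruct (geom_bounded_pos a s Ha) as [M [HM0 HM]]; [lra|].
  (* Bernoulli: [k * h <= (1 + h)^k = (s / rho)^k]. *)
  set (h := s / rho - 1).
  assert (Hh : 0 < h).
  { unfold h. apply Rmult_lt_reg_r with rho; [lra|].
    replace ((s / rho - 1) * rho) with (s - rho) by (field; lra). lra. }
  exists (M / h). intros k. rewrite Cmod_mult, Cmod_R.
  rewrite Rabs_pos_eq by apply pos_INR.
  apply Rmult_le_reg_r with h; [exact Hh|].
  replace (M / h * h) with M by (field; lra).
  assert (B := poly k h Hh).
  assert (P : s ^ k = rho ^ k * (1 + h) ^ k).
  { rewrite <- Rpow_mult_distr. f_equal. unfold h. field. lra. }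
  specialize (HM k). rewrite P in HM.
  assert (0 <= rho ^ k) by (apply pow_le; lra).
  assert (0 <= Cmod (a k)) by apply Cmod_ge_0.
  assert (0 <= Cmod (a k) * rho ^ k) by (apply Rmult_le_pos; assumption).
  nra.
Qed.

Lemma is_series_C_plus (u v : nat -> C) (l m : C) :
  @is_series C_AbsRing C_NormedModule u l ->
  @is_series C_AbsRing C_NormedModule v m ->
  @is_series C_AbsRing C_NormedModule (fun k => (u k + v k)%C) (l + m)%C.
Proof. intros H1 H2. exact (is_series_plus (V := C_NormedModule) u v l m H1 H2). Qed.

Lemma is_series_C_scal (c : C) (u : nat -> C) (l : C) :
  @is_series C_AbsRing C_NormedModule u l ->
  @is_series C_AbsRing C_NormedModule (fun k => (c * u k)%C) (c * l)%C.
Proof. intros H. exact (is_series_scal_l (V := C_NormedModule) c u l H). Qed.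

Lemma PS_add_coef (a b : nat -> C) (z : C) :
  geom_bounded a -> geom_bounded b -> Cmod z < 1 ->
  PS (fun k => (a k + b k)%C) z = (PS a z + PS b z)%C.
Proof.
  intros Ha Hb Hz. symmetry. apply PS_unique; [|exact Hz|].
  - apply geom_bounded_plus; assumption.
  - eapply is_series_ext; [|apply is_series_C_plus; apply PS_correct; eassumption].
    intros k. simpl. ring.
Qed.

Lemma PS_scal_coef (c : C) (a : nat -> C) (z : C) :
  geom_bounded a -> Cmod z < 1 ->
  PS (fun k => (c * a k)%C) z = (c * PS a z)%C.
Proof.
  intros Ha Hz. symmetry. apply PS_unique; [|exact Hz|].
  - apply geom_bounded_scal; assumption.
  - eapply is_series_ext; [|apply is_series_C_scal; apply PS_correct; eassumption].
    intros k. simpl. ring.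
Qed.

Lemma PS_ext_coef (a b : nat -> C) (z : C) : (forall k, a k = b k) -> PS a z = PS b z.
Proof.
  intros H. unfold PS, Cseries. f_equal; apply Series_ext; intros k; rewrite H; reflexivity.
Qed.

Lemma PS_step (a : nat -> C) (z : C) : geom_bounded a -> Cmod z < 1 ->
  PS a z = (a 0%nat + z * PS (fun k => a (S k)) z)%C.
Proof.
  intros Ha Hz. symmetry. apply PS_unique; [exact Ha|exact Hz|].
  assert (H := PS_correct _ z (geom_bounded_S a Ha) Hz).
  apply (is_series_C_scal z) in H.
  apply (is_series_decr_1 (V := C_NormedModule)).
  eapply is_series_ext with (fun k => (z * (a (S k) * z ^ k))%C).
  { intros k. simpl. ring. }
  eapply is_series_C_eq; [exact H|].
  change (z * PS (fun k => a (S k)) z =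
    a 0%nat + z * PS (fun k : nat => a (S k)) z + - (a 0%nat * z ^ 0))%C.
  simpl. ring.
Qed.

Lemma PS_shift (a : nat -> C) (n : nat) (z : C) : geom_bounded a -> Cmod z < 1 ->
  (forall k, (k < n)%nat -> a k = 0%C) ->
  PS a z = (z ^ n * PS (fun k => a (k + n)%nat) z)%C.
Proof.
  intros Ha Hz H. induction n as [|n IH].
  - rewrite (PS_ext_coef a (fun k => a (k + 0)%nat)) at 1; [simpl; ring|].
    intros k. f_equal. lia.
  - rewrite IH by (intros; apply H; lia).
    rewrite PS_step; [|apply geom_bounded_shift, Ha|exact Hz].
    rewrite H by lia.
    rewrite (PS_ext_coef (fun k => a (S k + n)%nat) (fun k => a (k + S n)%nat))
      by (intros k; f_equal; lia).
    simpl. ring.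
Qed.

Lemma PS_0 (a : nat -> C) : geom_bounded a -> PS a 0%C = a 0%nat.
Proof. intros H. rewrite PS_step; [ring|exact H|rewrite Cmod_0; lra]. Qed.

(** [dd m k z y] is the [m]-th divided difference of the monomial of degree
    [k] at the points [z, ..., z, y] ([m] times [z]).  The recursion on [k]
    is the Leibniz rule for the product of that monomial by the variable. *)
Fixpoint dd (m k : nat) (z y : C) : C :=
  match k with
  | O => match m with O => 1%C | S _ => 0%C end
  | S k' => match m with
            | O => (y * dd 0 k' z y)%C
            | S m' => (y * dd m k' z y + dd m' k' z z)%C
            end
  end.

Lemma dd_0 (k : nat) (z y : C) : dd 0 k z y = (y ^ k)%C.
Proof. induction k as [|k IH]; simpl; [reflexivity|]. rewrite IH. reflexivity. Qed.

(** The recursion defining [dd] does yield the next divided difference. *)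
Lemma dd_diff (m k : nat) (z y : C) :
  (dd m k z y - dd m k z z = (y - z) * dd (S m) k z y)%C.
Proof.
  induction k as [|k IH].
  - simpl. destruct m; ring.
  - destruct m as [|m]; simpl in *.
    + replace (y * dd 0 k z y - z * dd 0 k z z)%C
        with (y * (dd 0 k z y - dd 0 k z z) + (y - z) * dd 0 k z z)%C by ring.
      rewrite IH. ring.
    + replace (y * dd (S m) k z y + dd m k z z - (z * dd (S m) k z z + dd m k z z))%C
        with (y * (dd (S m) k z y - dd (S m) k z z) + (y - z) * dd (S m) k z z)%C by ring.
      rewrite IH. ring.
Qed.

Lemma dd_1_diag (k : nat) (z : C) : dd 1 (S k) z z = (INR (S k) * z ^ k)%C.
Proof.
  induction k as [|k IH].
  - simpl. ring.
  - change (dd 1 (S (S k)) z z) with (z * dd 1 (S k) z z + dd 0 (S k) z z)%C.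
    rewrite IH, dd_0, (S_INR (S k)), RtoC_plus. simpl (z ^ S k)%C. ring.
Qed.

(** On the disk of radius [rho] this divided difference is at most
    [C(k, m) * rho^(k - m)], which multiplied by [delta^m] is one term of
    the binomial expansion of [(rho + delta)^k].  Enlarging the radius by
    [delta] thus controls every order [m] by the same geometric sequence. *)
Lemma dd_bound (m k : nat) (z y : C) (rho delta : R) :
  0 < delta -> Cmod z <= rho -> Cmod y <= rho ->
  Cmod (dd m k z y) <= (rho + delta) ^ k / delta ^ m.
Proof.
  intros Hd Hz Hy. revert m y Hy. induction k as [|k IH]; intros m y Hy.
  - simpl. destruct m as [|m].
    + rewrite Cmod_1. simpl. lra.
    + rewrite Cmod_0. apply Rmult_le_pos; [lra|]. left. apply Rinv_0_lt_compat, pow_lt, Hd.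
  - assert (Hp : 0 <= (rho + delta) ^ k).
    { apply pow_le. assert (0 <= Cmod z) by apply Cmod_ge_0. lra. }
    destruct m as [|m]; simpl.
    + rewrite Cmod_mult. specialize (IH 0%nat y Hy). simpl in IH.
      assert (0 <= Cmod y) by apply Cmod_ge_0.
      assert (0 <= Cmod (dd 0 k z y)) by apply Cmod_ge_0.
      replace ((rho + delta) * (rho + delta) ^ k / 1)
        with ((rho + delta) * ((rho + delta) ^ k / 1)) by field.
      apply Rmult_le_compat; try assumption; lra.
    + eapply Rle_trans; [apply Cmod_triangle|]. rewrite Cmod_mult.
      assert (H1 := IH (S m) y Hy). assert (H2 := IH m z Hz).
      assert (Hm : 0 < delta ^ m) by (apply pow_lt, Hd).
      replace ((rho + delta) * (rho + delta) ^ k / (delta * delta ^ m))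
        with (rho * ((rho + delta) ^ k / delta ^ S m) + (rho + delta) ^ k / delta ^ m)
        by (simpl; field; lra).
      apply Rplus_le_compat; [|exact H2].
      apply Rmult_le_compat; auto using Cmod_ge_0.
Qed.

Definition PSdd (a : nat -> C) (m : nat) (z y : C) : C :=
  Cseries (fun k => (a k * dd m k z y)%C).

Lemma PSdd_majorant (a : nat -> C) (m : nat) (rho : R) :
  geom_bounded a -> 0 <= rho < 1 -> exists b : nat -> R, ex_series b /\
   forall z y, Cmod z <= rho -> Cmod y <= rho ->
   forall k, Cmod (a k * dd m k z y) <= b k.
Proof.
  intros Ha Hr. set (delta := (1 - rho) / 2).
  assert (Hd : 0 < delta) by (unfold delta; lra).
  exists (fun k => scal (/ delta ^ m) (Cmod (a k) * (rho + delta) ^ k)). split.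
  - apply (ex_series_scal_l (V := R_NormedModule)). apply geom_bounded_ex_series; [exact Ha|].
    unfold delta in *; lra.
  - intros z y Hz Hy k. rewrite Cmod_mult.
    replace (scal (/ delta ^ m) (Cmod (a k) * (rho + delta) ^ k))
      with (Cmod (a k) * ((rho + delta) ^ k / delta ^ m)).
    + apply Rmult_le_compat_l; [apply Cmod_ge_0|]. apply dd_bound; assumption.
    + change (Cmod (a k) * ((rho + delta) ^ k / delta ^ m) =
        / delta ^ m * (Cmod (a k) * (rho + delta) ^ k)).
      field. apply pow_nonzero. lra.
Qed.

Lemma PSdd_ex_series (a : nat -> C) (m : nat) (z y : C) :
  geom_bounded a -> Cmod z < 1 -> Cmod y < 1 ->
  ex_series (fun k => Cmod (a k * dd m k z y)).
Proof.
  intros Ha Hz Hy.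
  destruct (PSdd_majorant a m (Rmax (Cmod z) (Cmod y)) Ha) as [b [Hb H]].
  - split; [|apply Rmax_lub_lt; assumption].
    eapply Rle_trans; [apply Cmod_ge_0|apply Rmax_l].
  - apply (ex_series_le (V := R_CompleteNormedModule) _ b); [|exact Hb].
    intros k. change (Rabs (Cmod (a k * dd m k z y)) <= b k).
    rewrite Rabs_pos_eq by apply Cmod_ge_0.
    apply H; [apply Rmax_l|apply Rmax_r].
Qed.

Lemma sum_n_Cmod (u : nat -> C) (b : nat -> R) (n : nat) :
  (forall k, Cmod (u k) <= b k) -> Cmod (sum_n u n) <= sum_n b n.
Proof.
  intros H. induction n as [|n IH].
  - rewrite !sum_O. apply H.
  - rewrite !sum_Sn.
    change (Cmod (sum_n u n + u (S n)) <= sum_n b n + b (S n)).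
    eapply Rle_trans; [apply Cmod_triangle|]. apply Rplus_le_compat; auto.
Qed.

Lemma Cseries_bound (u : nat -> C) (b : nat -> R) :
  (forall k, Cmod (u k) <= b k) -> ex_series b -> Cmod (Cseries u) <= Series b.
Proof.
  intros H Hb.
  assert (Hu : ex_series (fun k => Cmod (u k))).
  { apply (ex_series_le (V := R_CompleteNormedModule) _ b); [|exact Hb].
    intros k. change (Rabs (Cmod (u k)) <= b k).
    rewrite Rabs_pos_eq by apply Cmod_ge_0. apply H. }
  apply (is_series_C_bound u); [apply Cseries_correct, Hu|].
  intros n. eapply Rle_trans; [apply sum_n_Cmod, H|].
  rewrite sum_n_Reals. apply sum_incr.
  - apply is_series_Reals, Series_correct, Hb.
  - intros k. eapply Rle_trans; [apply Cmod_ge_0|apply H].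
Qed.

Lemma PSdd_diff (a : nat -> C) (m : nat) (z y : C) :
  geom_bounded a -> Cmod z < 1 -> Cmod y < 1 ->
  PSdd a m z y = (PSdd a m z z + (y - z) * PSdd a (S m) z y)%C.
Proof.
  intros Ha Hz Hy. symmetry. apply Cseries_unique; [apply PSdd_ex_series; assumption|].
  eapply is_series_ext;
    [|apply is_series_C_plus; [|apply is_series_C_scal];
      apply Cseries_correct, PSdd_ex_series; assumption].
  intros k. simpl.
  replace (a k * dd m k z y)%C
    with (a k * dd m k z z + a k * (dd m k z y - dd m k z z))%C by ring.
  rewrite dd_diff. ring.
Qed.

Lemma PSdd_taylor (a : nat -> C) (z : C) (j m : nat) :
  geom_bounded a -> Cmod z < 1 -> taylor j (PSdd a m z) z.
Proof.
  intros Ha Hz. revert m. induction j as [|j IH]; intros m.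
  - set (s := (1 + Cmod z) / 2). assert (0 <= Cmod z) by apply Cmod_ge_0.
    destruct (PSdd_majorant a m s Ha) as [b [Hb H1]]; [unfold s; lra|].
    exists (Series b). generalize (near_disk s z ltac:(unfold s; lra)).
    apply near_mono. intros y Hy. apply Cseries_bound; [|exact Hb].
    apply H1; [unfold s; lra|lra].
  - exists (PSdd a (S m) z). split; [apply IH|].
    generalize (near_disk 1 z Hz). apply near_mono. intros y Hy.
    apply PSdd_diff; assumption.
Qed.

Lemma PSdd_0 (a : nat -> C) (z y : C) : PSdd a 0 z y = PS a y.
Proof.
  unfold PSdd, PS, Cseries.
  f_equal; apply Series_ext; intros k; rewrite dd_0; reflexivity.
Qed.

Lemma PS_taylor (a : nat -> C) (z : C) (m : nat) :
  geom_bounded a -> Cmod z < 1 -> taylor m (PS a) z.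
Proof.
  intros Ha Hz. apply (taylor_ext m (PSdd a 0 z)); [|apply PSdd_taylor; assumption].
  exists 1. split; [lra|]. intros; apply PSdd_0.
Qed.

Lemma PS_has_der (a : nat -> C) (z : C) : geom_bounded a -> Cmod z < 1 ->
  has_der (PS a) z (PS (fun k => (INR (S k) * a (S k))%C) z).
Proof.
  intros Ha Hz. exists (PSdd a 1 z). repeat split.
  - apply PSdd_taylor; assumption.
  - assert (G := geom_bounded_S _ (geom_bounded_INR a Ha)).
    apply PS_unique; [exact G|exact Hz|].
    assert (H := Cseries_correct _ (PSdd_ex_series a 1 z z Ha Hz Hz)).
    apply (is_series_ext (fun k => (a (S k) * dd 1 (S k) z z)%C)).
    { intros k. rewrite dd_1_diag.
      change (a (S k) * (INR (S k) * z ^ k) = INR (S k) * a (S k) * z ^ k)%C. ring. }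
    apply (is_series_incr_1 (V := C_NormedModule) (fun k => (a k * dd 1 k z z)%C)).
    eapply is_series_C_eq; [exact H|].
    change (PSdd a 1 z z = PSdd a 1 z z + a 0%nat * 0)%C. ring.
  - generalize (near_disk 1 z Hz). apply near_mono. intros y Hy.
    rewrite <- !(PSdd_0 a z). apply PSdd_diff; assumption.
Qed.

(** The Euler operator [z d/dz] multiplies the [k]-th coefficient by [k]. *)
Lemma PS_euler (a : nat -> C) (z : C) : geom_bounded a -> Cmod z < 1 ->
  (z * PS (fun k => (INR (S k) * a (S k))%C) z = PS (fun k => (INR k * a k)%C) z)%C.
Proof.
  intros Ha Hz. rewrite (PS_step (fun k => (INR k * a k)%C)); auto using geom_bounded_INR.
  simpl (INR 0). ring.
Qed.

(** * The maximum principle *)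

(** Compactness of the closed disk in the form of a Lebesgue number.  The
    scale [d] is also a parameter of the property, so that bounding a
    function and bounding it away from its supremum are both instances. *)
Lemma disk_uniform (s : R) (P : R -> C -> Prop) :
  (forall d e y, 0 < e <= d -> P d y -> P e y) ->
  (forall z, Cmod z <= s -> exists d, 0 < d /\ near z (fun y => Cmod y <= s -> P d y)) ->
  exists d, 0 < d /\ forall y, Cmod y <= s -> P d y.
Proof.
  intros Hmono Hloc.
  assert (H : forall u v : R, exists d : posreal,
    forall y, Cmod (y - (u, v)) < 2 * d -> Cmod y <= s -> P d y).
  { intros u v. destruct (Rle_or_lt (Cmod (u, v)) s) as [Hin|Hout].
    - destruct (Hloc _ Hin) as [d [Hd [e [He HP]]]].
      assert (Hm : 0 < Rmin d (e / 2)) by (apply Rmin_pos; lra).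
      exists (mkposreal _ Hm). simpl. intros y Hy Hys.
      apply (Hmono d); [split; [exact Hm|apply Rmin_l]|].
      apply HP; [|exact Hys]. assert (H := Rmin_r d (e / 2)). lra.
    - assert (Hm : 0 < (Cmod (u, v) - s) / 2) by lra.
      exists (mkposreal _ Hm). simpl. intros y Hy Hys. exfalso.
      assert (Cmod (u, v) <= Cmod y + Cmod (y - (u, v))).
      { rewrite Cmod_minus_sym.
        replace (u, v) with (y + ((u, v) - y))%C at 1 by ring. apply Cmod_triangle. }
      lra. }
  set (delta u v := proj1_sig (constructive_indefinite_description _ (H u v))).
  assert (Hdelta : forall u v y, Cmod (y - (u, v)) < 2 * delta u v -> Cmod y <= s ->
    P (delta u v) y).
  { intros u v. exact (proj2_sig (constructive_indefinite_description _ (H u v))). }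
  destruct (compactness_value_2d (- s) s (- s) s delta) as [d Hd].
  exists d. split; [apply cond_pos|]. intros y Hy. apply NNPP. intros HN.
  assert (Hr := re_le_Cmod y). assert (Hi := Im_le_Cmod y).
  apply (Hd (Re y) (Im y)).
  - apply Rabs_le_between; lra.
  - apply Rabs_le_between; lra.
  - intros [u [v [_ [_ [Hu [Hv Hle]]]]]]. apply HN.
    apply (Hmono (delta u v)); [split; [apply cond_pos|exact Hle]|].
    apply Hdelta; [|exact Hy].
    destruct y as [y1 y2].
    change ((y1, y2) - (u, v))%C with (y1 - u, y2 - v).
    eapply Rle_lt_trans; [apply Cmod_le_abs|]. simpl in Hu, Hv. lra.
Qed.

Lemma disk_max (s : R) (u : C -> R) :
  0 <= s ->
  (forall z eps, Cmod z <= s -> 0 < eps -> near z (fun y => u y < u z + eps)) ->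
  exists z0, Cmod z0 <= s /\ forall z, Cmod z <= s -> u z <= u z0.
Proof.
  intros Hs Hu.
  assert (B : exists d, 0 < d /\ forall y, Cmod y <= s -> u y <= / d).
  { apply (disk_uniform s (fun d y => u y <= / d)).
    - intros d e y He H. eapply Rle_trans; [exact H|].
      apply Rinv_le_contravar; lra.
    - intros z Hz. assert (Hp : 0 < Rabs (u z) + 1) by (assert (H := Rabs_pos (u z)); lra).
      exists (/ (Rabs (u z) + 1)). split; [apply Rinv_0_lt_compat, Hp|].
      generalize (Hu z 1 Hz Rlt_0_1). apply near_mono. intros y Hy _.
      rewrite Rinv_inv. assert (H := Rle_abs (u z)). lra. }
  destruct B as [d0 [Hd0 B]].
  set (E x := exists z, Cmod z <= s /\ u z = x).
  destruct (completeness E) as [M [HM1 HM2]].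
  { exists (/ d0). intros x [z [Hz <-]]. apply B, Hz. }
  { exists (u 0%C), 0%C. rewrite Cmod_0. auto. }
  apply NNPP. intros HN.
  assert (HM : forall z, Cmod z <= s -> u z < M).
  { intros z Hz. destruct (Rle_lt_or_eq_dec (u z) M) as [H|H]; [|exact H|].
    - apply HM1. exists z. auto.
    - exfalso. apply HN. exists z. split; [exact Hz|]. intros y Hy.
      rewrite H. apply HM1. exists y. auto. }
  destruct (disk_uniform s (fun d y => u y <= M - d)) as [d [Hd H]].
  - intros d e y He H. lra.
  - intros z Hz. specialize (HM z Hz). exists ((M - u z) / 2). split; [lra|].
    generalize (Hu z ((M - u z) / 2) Hz ltac:(lra)). apply near_mono.
    intros y Hy _. lra.
  - assert (M <= M - d); [|lra]. apply HM2. intros x [z [Hz <-]]. apply H, Hz.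
Qed.

Lemma taylor_3_expansion (F : C -> C) (z : C) : taylor 3 F z ->
  exists c1 c2 K, 0 <= K /\ near z (fun y =>
    Cmod (F y - (F z + c1 * (y - z) + c2 * (y - z) ^ 2)) <= K * Cmod (y - z) ^ 3).
Proof.
  intros [f1 [[f2 [[f3 [[K HK] E3]] E2]] E1]].
  exists (f1 z), (f2 z), K. split.
  - eapply Rle_trans; [apply Cmod_ge_0|]. apply (near_at _ _ HK).
  - generalize (near_and _ _ _ HK (near_and _ _ _ E3 (near_and _ _ _ E2 E1))).
    apply near_mono. intros y [Hb [-> [-> ->]]].
    replace (F z + (y - z) * (f1 z + (y - z) * (f2 z + (y - z) * f3 y)) -
      (F z + f1 z * (y - z) + f2 z * (y - z) ^ 2))%C
      with (f3 y * (y - z) ^ 3)%C by ring.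
    rewrite Cmod_mult, Cmod_pow.
    apply Rmult_le_compat_r; [apply pow_le, Cmod_ge_0|exact Hb].
Qed.

Lemma Cmod_sqr (x y : R) : Cmod (x, y) ^ 2 = x ^ 2 + y ^ 2.
Proof. rewrite Cmod2_alt. reflexivity. Qed.

Lemma Cmod_sqr_perturb (F P : C) (B e : R) :
  Cmod P <= B -> Cmod (F - P) <= e -> Cmod P ^ 2 - 2 * B * e <= Cmod F ^ 2.
Proof.
  intros HP HE.
  assert (Cmod P <= Cmod F + Cmod (F - P)).
  { rewrite Cmod_minus_sym. replace P with (F + (P - F))%C at 1 by ring.
    apply Cmod_triangle. }
  assert (0 <= Cmod F) by apply Cmod_ge_0.
  assert (0 <= Cmod P) by apply Cmod_ge_0.
  assert (0 <= Cmod (F - P)) by apply Cmod_ge_0.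
  assert (Cmod P * Cmod (F - P) <= B * e) by (apply Rmult_le_compat; assumption).
  destruct (Rle_or_lt (Cmod P) (Cmod (F - P))) as [Hc|Hc]; nra.
Qed.

(** The mixed terms of [|P|^2] carry factors [h], [h^2] or [h |h|^2] and
    their conjugates, whose sums over the square [t, it, -t, -it] vanish.
    This mean replaces the computation of a Laplacian. *)
Lemma square_mean (c0 c1 c2 : C) (t : R) :
  let P (h : C) := (c0 + c1 * h + c2 * h ^ 2)%C in
  Cmod (P t) ^ 2 + Cmod (P (Ci * t)%C) ^ 2 + Cmod (P (- t)%C) ^ 2
    + Cmod (P (- (Ci * t))%C) ^ 2
  = 4 * (Cmod c0 ^ 2 + Cmod c1 ^ 2 * t ^ 2 + Cmod c2 ^ 2 * t ^ 4).
Proof.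
  destruct c0 as [a0 b0], c1 as [a1 b1], c2 as [a2 b2].
  unfold Ci, RtoC, Copp, Cmult, Cplus. simpl Cpow.
  unfold Ci, RtoC, Copp, Cmult, Cplus. cbn [fst snd].
  rewrite !Cmod_sqr. ring.
Qed.

(** [|F|^2 + eps |z|^2] is strictly subharmonic, hence has no interior local
    maximum: its mean over a small square around [z] exceeds the value at
    [z] by at least [eps t^2], against an error of order [t^3].  The
    perturbation by [eps] makes the inequality strict, which spares any
    discussion of functions that are constant near [z]. *)
Lemma no_local_max (F : C -> C) (z : C) (eps : R) :
  0 < eps -> taylor 3 F z ->
  ~ near z (fun y => Cmod (F y) ^ 2 + eps * Cmod y ^ 2
                     <= Cmod (F z) ^ 2 + eps * Cmod z ^ 2).
Proof.
  intros He T Hmax.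
  destruct (taylor_3_expansion F z T) as [c1 [c2 [K [HK HT]]]].
  destruct (near_and _ _ _ Hmax HT) as [d [Hd H]]. clear Hmax HT.
  set (B := Cmod (F z) + Cmod c1 + Cmod c2).
  assert (Hc0 := Cmod_ge_0 (F z)). assert (Hc1 := Cmod_ge_0 c1).
  assert (Hc2 := Cmod_ge_0 c2).
  assert (HB : 0 <= B) by (unfold B; lra).
  assert (HBK : 0 <= B * K) by (apply Rmult_le_pos; assumption).
  (* [t] small enough for the remainder [8 B K t^3] to be beaten by
     [4 eps t^2]. *)
  set (t := Rmin (Rmin (d / 2) 1) (eps / (2 * B * K + 1))).
  assert (Ht : 0 < t).
  { unfold t. repeat apply Rmin_pos; try lra. apply Rdiv_lt_0_compat; lra. }
  assert (Htd : t <= d / 2).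
  { unfold t. eapply Rle_trans; [apply Rmin_l|apply Rmin_l]. }
  assert (Ht1 : t <= 1).
  { unfold t. eapply Rle_trans; [apply Rmin_l|apply Rmin_r]. }
  assert (Hte : t * (2 * B * K + 1) <= eps).
  { apply Rmult_le_reg_r with (/ (2 * B * K + 1)); [apply Rinv_0_lt_compat; lra|].
    rewrite Rmult_assoc, Rinv_r, Rmult_1_r by lra. apply Rmin_r. }
  set (P (h : C) := (F z + c1 * h + c2 * h ^ 2)%C).
  assert (Hone : forall h, Cmod h = t ->
    Cmod (P h) ^ 2 - 2 * B * (K * t ^ 3) + eps * Cmod (z + h) ^ 2
      <= Cmod (F z) ^ 2 + eps * Cmod z ^ 2).
  { intros h Hh. destruct (H (z + h)%C) as [H1 H2].
    - replace (z + h - z)%C with h by ring. lra.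
    - replace (z + h - z)%C with h in H2 by ring. fold (P h) in H2. rewrite Hh in H2.
      assert (HP : Cmod (P h) <= B).
      { unfold P, B. eapply Rle_trans; [apply Cmod_triangle|].
        rewrite Cmod_mult, Cmod_pow, Hh.
        assert (H3 := Cmod_triangle (F z) (c1 * h)%C). rewrite Cmod_mult, Hh in H3.
        assert (t ^ 2 <= 1) by nra. assert (0 <= t ^ 2) by nra. nra. }
      assert (H3 := Cmod_sqr_perturb _ _ _ _ HP H2). lra. }
  assert (Hmean := square_mean (F z) c1 c2 t). cbv beta zeta in Hmean.
  fold (P t) (P (Ci * t)%C) (P (- t)%C) (P (- (Ci * t))%C) in Hmean.
  assert (Hsq := square_mean z 1 0 t). cbv beta zeta in Hsq.
  assert (E : forall h : C, (z + 1 * h + 0 * h ^ 2 = z + h)%C) by (intros; ring).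
  rewrite !E, Cmod_1, Cmod_0 in Hsq.
  assert (Ct : Cmod t = t) by (rewrite Cmod_R, Rabs_pos_eq; lra).
  assert (A1 := Hone t Ct).
  assert (A2 := Hone (Ci * t)%C ltac:(rewrite Cmod_mult, Cmod_Ci, Ct; ring)).
  assert (A3 := Hone (- t)%C ltac:(rewrite Cmod_opp; exact Ct)).
  assert (A4 := Hone (- (Ci * t))%C ltac:(rewrite Cmod_opp, Cmod_mult, Cmod_Ci, Ct; ring)).
  assert (0 <= Cmod c1 ^ 2 * t ^ 2) by (apply Rmult_le_pos; apply pow2_ge_0).
  assert (0 <= Cmod c2 ^ 2 * t ^ 4).
  { apply Rmult_le_pos; [apply pow2_ge_0|]. apply pow_le; lra. }
  assert (Hsum : eps * (4 * t ^ 2) <= 4 * (2 * B * (K * t ^ 3))) by nra.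
  assert (Ht2 : 0 < t ^ 2) by (apply pow_lt, Ht).
  assert (eps <= 2 * B * K * t); [|nra].
  apply Rmult_le_reg_l with (4 * t ^ 2); [lra|].
  replace (4 * t ^ 2 * (2 * B * K * t)) with (4 * (2 * B * (K * t ^ 3))) by ring. lra.
Qed.

Definition smooth (m : nat) (F : C -> C) : Prop :=
  forall z, Cmod z < 1 -> taylor m F z.

Theorem max_principle (F : C -> C) (s B : R) :
  smooth 3 F -> 0 <= s < 1 -> 0 <= B ->
  (forall z, Cmod z = s -> Cmod (F z) <= B) ->
  forall z, Cmod z <= s -> Cmod (F z) <= B.
Proof.
  intros HF Hs HB Hbd z1 Hz1. apply Rnot_lt_le. intros Hlt.
  (* [eps] so small that the value at [z1] still beats the boundary. *)
  set (eps := (Cmod (F z1) ^ 2 - B ^ 2) / 2).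
  assert (He : 0 < eps) by (unfold eps; nra).
  set (u y := Cmod (F y) ^ 2 + eps * Cmod y ^ 2).
  destruct (disk_max s u) as [z0 [Hz0 Hmax]]; [lra| |].
  - intros z e Hz He'.
    assert (T : taylor 1 F z) by (apply (taylor_le 1 3); [lia|apply HF; lra]).
    set (M := 2 * Cmod (F z) + 1 + eps * (2 * Cmod z + 1)).
    assert (H0 := Cmod_ge_0 (F z)). assert (H0' := Cmod_ge_0 z).
    assert (HM : 0 < M) by (unfold M; nra).
    assert (He2 : 0 < Rmin 1 (e / M)) by (apply Rmin_pos; [lra|apply Rdiv_lt_0_compat; lra]).
    generalize (near_and _ _ _ (taylor_1_continuous F z _ T He2)
      (taylor_1_continuous (fun y => y) z _ (taylor_id 1 z) He2)).
    apply near_mono. cbv beta. intros y [H1 H2]. unfold u.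
    set (w := Rmin 1 (e / M)) in *.
    assert (Hw1 : w <= 1) by apply Rmin_l.
    assert (HwM : w * M <= e).
    { apply Rmult_le_reg_r with (/ M); [apply Rinv_0_lt_compat, HM|].
      rewrite Rmult_assoc, Rinv_r, Rmult_1_r by lra. apply Rmin_r. }
    assert (G : forall x x' : C, Cmod (x' - x) < w -> 
      Cmod x' ^ 2 < Cmod x ^ 2 + w * (2 * Cmod x + 1)).
    { intros x x' Hx. assert (Cmod x' <= Cmod x + Cmod (x' - x)).
      { replace x' with (x + (x' - x))%C at 1 by ring. apply Cmod_triangle. }
      assert (G1 := Cmod_ge_0 x). assert (G2 := Cmod_ge_0 x').
      assert (Cmod x' < Cmod x + w) by lra. nra. }
    assert (G1 := G _ _ H1). assert (G2 := G _ _ H2).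
    apply (Rmult_lt_compat_l eps) in G2; [|exact He]. unfold M in HwM. lra.
  - destruct (Rle_lt_or_eq_dec _ _ Hz0) as [Hin|Hbdz].
    + apply (no_local_max F z0 eps He (HF z0 ltac:(lra))).
      generalize (near_disk s z0 Hin). apply near_mono. intros y Hy.
      apply (Hmax y). lra.
    + assert (H1 := Hmax z1 Hz1). unfold u in H1.
      assert (H2 := Hbd z0 Hbdz). rewrite Hbdz in H1.
      assert (H3 := Cmod_ge_0 (F z0)). assert (H4 := Cmod_ge_0 z1).
      assert (Cmod (F z0) ^ 2 <= B ^ 2) by (apply pow_incr; lra).
      assert (s ^ 2 <= 1) by nra.
      assert (eps * s ^ 2 <= eps * 1) by (apply Rmult_le_compat_l; lra).
      assert (0 <= eps * Cmod z1 ^ 2) by (apply Rmult_le_pos; [lra|apply pow2_ge_0]).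
      unfold eps in *. lra.
Qed.

(** * Schwarz and Schwarz-Pick *)

Lemma limit_left_1 (h : R -> R) (x r : R) :
  r < 1 -> ex_derive h 1 -> (forall s, r < s < 1 -> x <= h s) -> x <= h 1.
Proof.
  intros Hr Hh H. apply Rnot_lt_le. intros Hlt.
  assert (Hc := ex_derive_continuous (V := R_NormedModule) h 1 Hh).
  assert (He : 0 < x - h 1) by lra.
  destruct (proj1 (filterlim_locally (U := R_UniformSpace) _ _) Hc (mkposreal _ He))
    as [d Hd].
  assert (Hm : 0 < Rmin d (1 - r)) by (apply Rmin_pos; [apply cond_pos|lra]).
  assert (H1 := Rmin_l d (1 - r)). assert (H2 := Rmin_r d (1 - r)).
  set (s := 1 - Rmin d (1 - r) / 2).
  assert (Hs := H s ltac:(unfold s; lra)).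
  assert (Hb : Rabs (s - 1) < d) by (unfold s; rewrite Rabs_left; lra).
  specialize (Hd s Hb).
  change (Rabs (h s - h 1) < x - h 1) in Hd. apply Rabs_lt_between in Hd. lra.
Qed.

(** Schwarz's lemma for a zero of order [n]: on the circle of radius [s] the
    quotient is at most [s^(-n)], so the maximum principle bounds it there
    by a quantity tending to [1]. *)
Lemma schwarz (n : nat) (w phi : C -> C) :
  smooth 3 phi ->
  (forall z, Cmod z < 1 -> w z = (z ^ n * phi z)%C) ->
  (forall z, Cmod z < 1 -> Cmod (w z) <= 1) ->
  forall z, Cmod z < 1 -> Cmod (phi z) <= 1.
Proof.
  intros Hphi Hw Hb z Hz. assert (Hz0 := Cmod_ge_0 z).
  replace 1 with (/ 1 ^ n) by (rewrite pow1; field).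
  apply (limit_left_1 (fun s => / s ^ n) _ (Cmod z) Hz).
  - auto_derive. rewrite pow1. lra.
  - intros s Hs.
    assert (Hsn : 0 < s ^ n) by (apply pow_lt; lra).
    apply (max_principle phi s); [exact Hphi|lra| | |lra].
    + left. apply Rinv_0_lt_compat, Hsn.
    + intros y Hy. specialize (Hb y ltac:(lra)). rewrite Hw in Hb by lra.
      rewrite Cmod_mult, Cmod_pow, Hy in Hb.
      apply Rmult_le_reg_l with (s ^ n); [exact Hsn|]. rewrite Rinv_r; lra.
Qed.

(** Removable singularity: the quotient is the divided difference at [z0], at
    the price of one order of smoothness. *)
Lemma smooth_div_root (m : nat) (F : C -> C) (z0 : C) :
  Cmod z0 < 1 -> smooth (S (S m)) F -> F z0 = 0%C ->
  exists G, smooth (S m) G /\ forall z, Cmod z < 1 -> F z = ((z - z0) * G z)%C.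
Proof.
  intros Hz0 HF H0. destruct (HF z0 Hz0) as [f1 [T1 H1]].
  exists (fun y => if Ceq_dec y z0 then f1 z0 else (F y * / (y - z0))%C).
  assert (Hsub : forall y : C, y <> z0 -> (y - z0)%C <> 0%C).
  { intros y Hy E. apply Hy. replace y with ((y - z0) + z0)%C by ring. rewrite E. ring. }
  split.
  - intros z Hz. destruct (Ceq_dec z z0) as [->|Hne].
    + apply (taylor_ext (S m) f1); [|exact T1].
      revert H1. apply near_mono. intros y Hy.
      destruct (Ceq_dec y z0) as [->|Hy0]; [reflexivity|].
      rewrite Hy, H0. field. apply Hsub, Hy0.
    + apply (taylor_ext (S m) (fun y => F y * / (y - z0))%C).
      * generalize (near_neq z z0 Hne). apply near_mono. intros y Hy.
        destruct (Ceq_dec y z0); [contradiction|reflexivity].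
      * apply taylor_mult; [apply taylor_pred, HF, Hz|].
        apply (taylor_inv m (fun y => (y - z0)%C)); [|apply Hsub, Hne].
        apply taylor_minus; [apply taylor_id|apply taylor_const].
  - intros z Hz. destruct (Ceq_dec z z0) as [->|Hne].
    + rewrite H0. ring.
    + field. apply Hsub, Hne.
Qed.

Lemma moebius_identity (a b : C) :
  Cmod (1 - Cconj a * b) ^ 2 - Cmod (b - a) ^ 2
  = (1 - Cmod a ^ 2) * (1 - Cmod b ^ 2).
Proof. rewrite !Cmod2_alt. destruct a as [a1 a2], b as [b1 b2]. simpl. ring. Qed.

Lemma moebius_denom (a b : C) : Cmod a < 1 -> Cmod b <= 1 -> (1 - Cconj a * b)%C <> 0%C.
Proof.
  intros Ha Hb E.
  assert (H : Cmod (Cconj a * b) = 1).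
  { replace (Cconj a * b)%C with (1 - (1 - Cconj a * b))%C by ring.
    rewrite E. replace (1 - 0)%C with (RtoC 1) by ring. apply Cmod_1. }
  rewrite Cmod_mult, Cmod_conj in H.
  assert (0 <= Cmod a) by apply Cmod_ge_0. assert (0 <= Cmod b) by apply Cmod_ge_0. nra.
Qed.

Lemma moebius_le (a b : C) : Cmod a < 1 -> Cmod b <= 1 ->
  Cmod (b - a) <= Cmod (1 - Cconj a * b).
Proof.
  intros Ha Hb. assert (H := moebius_identity a b).
  assert (H1 := Cmod_ge_0 a). assert (H2 := Cmod_ge_0 b).
  assert (0 <= (1 - Cmod a ^ 2) * (1 - Cmod b ^ 2)) by (apply Rmult_le_pos; nra).
  apply Rsqr_incr_0_var; [|apply Cmod_ge_0].
  unfold Rsqr. lra.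
Qed.

(** Both variables are moved to the origin by disk automorphisms, which
    leaves a function bounded by [1] with a zero at [z0]; dividing by the
    automorphism in the source gives the derivative as a value. *)
Lemma schwarz_pick_strict (phi : C -> C) (t : R) (z0 d : C) :
  t < 1 -> smooth 4 phi -> (forall z, Cmod z < 1 -> Cmod (phi z) <= t) ->
  Cmod z0 < 1 -> has_der phi z0 d ->
  Cmod d * (1 - Cmod z0 ^ 2) <= 1 - Cmod (phi z0) ^ 2.
Proof.
  intros Ht Hphi Hb Hz0 Hd. set (c := phi z0).
  assert (Hc : Cmod c <= t) by (apply Hb, Hz0).
  assert (Hc0 := Cmod_ge_0 c). assert (Hz00 := Cmod_ge_0 z0).
  assert (Hden : forall z, Cmod z < 1 -> (1 - Cconj c * phi z)%C <> 0%C).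
  { intros z Hz. apply moebius_denom; [lra|]. specialize (Hb z Hz). lra. }
  destruct (smooth_div_root 2 (fun z => (phi z - c) * / (1 - Cconj c * phi z))%C z0 Hz0)
    as [G [HG HGe]].
  { intros z Hz. apply taylor_mult.
    - apply taylor_minus; [apply Hphi, Hz|apply taylor_const].
    - apply (taylor_inv 3 (fun y => (1 - Cconj c * phi y)%C)); [|apply Hden, Hz].
      apply taylor_minus; [apply taylor_const|].
      apply taylor_mult; [apply taylor_const|apply Hphi, Hz]. }
  { unfold c. ring. }
  cbv beta in HGe.
  assert (Hmul : forall z, Cmod z < 1 -> (phi z - c = (z - z0) * (G z * (1 - Cconj c * phi z)))%C).
  { intros z Hz. assert (E := HGe z Hz).
    transitivity ((phi z - c) * / (1 - Cconj c * phi z) * (1 - Cconj c * phi z))%C.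
    - field. apply Hden, Hz.
    - rewrite E. ring. }
  assert (Ed : d = (G z0 * (1 - Cconj c * c))%C).
  { apply (has_der_unique phi z0); [exact Hd|].
    exists (fun z => (G z * (1 - Cconj c * phi z))%C). repeat split.
    - apply taylor_mult; [apply (taylor_le 1 3); [lia|apply HG, Hz0]|].
      apply taylor_minus; [apply taylor_const|].
      apply taylor_mult; [apply taylor_const|].
      apply (taylor_le 1 4); [lia|apply Hphi, Hz0].
    - generalize (near_disk 1 z0 Hz0). apply near_mono. intros y Hy.
      rewrite <- (Hmul y Hy). unfold c. ring. }
  set (F z := (G z * (1 - Cconj z0 * z))%C).
  assert (HF : smooth 3 F).
  { intros z Hz. apply taylor_mult; [apply HG, Hz|].
    apply taylor_minus; [apply taylor_const|].
    apply taylor_mult; [apply taylor_const|apply taylor_id]. }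
  assert (Ecc : forall a : C, Cmod (1 - Cconj a * a) = Rabs (1 - Cmod a ^ 2)).
  { intros a. rewrite Cmult_comm, <- Cmod2_conj.
    rewrite <- RtoC_minus, Cmod_R. reflexivity. }
  assert (HF0 : Cmod (F z0) <= 1).
  { set (r := Cmod z0).
    replace 1 with (sqrt (1 + (1 - 1 ^ 2) / (1 - r) ^ 2))
      by (replace (1 + (1 - 1 ^ 2) / (1 - r) ^ 2) with 1 by (field; unfold r; lra);
          apply sqrt_1).
    apply (limit_left_1 (fun s => sqrt (1 + (1 - s ^ 2) / (s - r) ^ 2)) _ r Hz0).
    - auto_derive. split.
      + assert (0 < 1 - r) by (unfold r; lra). nra.
      + split; [|exact I].
        replace (1 + (1 - 1 * (1 * 1)) * / ((1 - r) * ((1 - r) * 1))) with 1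
          by (field; unfold r; lra). lra.
    - intros s Hs.
      apply (max_principle F s);
        [exact HF|unfold r in Hs; lra|apply sqrt_pos| |unfold r in Hs; lra].
      intros z Hz. assert (Hzs : Cmod z < 1) by lra.
      assert (HN : Cmod ((z - z0) * G z) <= 1).
      { rewrite <- HGe by exact Hzs.
        assert (Hb' := Hb z Hzs).
        rewrite Cmod_mult, Cmod_inv by (apply Hden, Hzs).
        assert (Hp : 0 < Cmod (1 - Cconj c * phi z)) by (apply Cmod_gt_0, Hden, Hzs).
        apply Rmult_le_reg_r with (Cmod (1 - Cconj c * phi z)); [exact Hp|].
        rewrite Rmult_assoc, Rinv_l, Rmult_1_r, Rmult_1_l by lra.
        apply moebius_le; lra. }
      rewrite Cmod_mult in HN.
      assert (Hdist : s - r <= Cmod (z - z0)).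
      { unfold r. rewrite <- Hz.
        assert (Cmod z <= Cmod (z - z0) + Cmod z0); [|lra].
        replace z with ((z - z0) + z0)%C at 1 by ring. apply Cmod_triangle. }
      set (D := Cmod (z - z0)) in *.
      assert (Hmi := moebius_identity z0 z). fold D in Hmi. rewrite Hz in Hmi. fold r in Hmi.
      assert (HD2 : Cmod (1 - Cconj z0 * z) <= D * sqrt (1 + (1 - s ^ 2) / (s - r) ^ 2)).
      { assert (Hr0 : 0 <= r) by (unfold r; lra).
        assert (Hq : 0 <= (1 - s ^ 2) / (s - r) ^ 2).
        { apply Rmult_le_pos; [nra|]. left. apply Rinv_0_lt_compat, pow_lt. lra. }
        apply Rsqr_incr_0_var; [|apply Rmult_le_pos; [lra|apply sqrt_pos]].
        rewrite Rsqr_mult, Rsqr_sqrt by lra. unfold Rsqr.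
        assert (Hq' : (1 - s ^ 2) <= D * D * ((1 - s ^ 2) / (s - r) ^ 2)).
        { replace (1 - s ^ 2) with ((s - r) ^ 2 * ((1 - s ^ 2) / (s - r) ^ 2)) at 1
            by (field; lra).
          apply Rmult_le_compat_r; [exact Hq|]. nra. }
        assert ((1 - r ^ 2) * (1 - s ^ 2) <= 1 * (1 - s ^ 2))
          by (apply Rmult_le_compat_r; nra).
        lra. }
      unfold F. rewrite Cmod_mult.
      eapply Rle_trans; [apply Rmult_le_compat_l; [apply Cmod_ge_0|exact HD2]|].
      rewrite <- Rmult_assoc.
      rewrite <- (Rmult_1_l (sqrt _)) at 2. apply Rmult_le_compat_r; [apply sqrt_pos|].
      lra. }
  unfold F in HF0. rewrite Cmod_mult, Ecc in HF0.
  rewrite Ed, Cmod_mult, Ecc.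
  assert (0 < 1 - Cmod c ^ 2) by nra. assert (0 < 1 - Cmod z0 ^ 2) by nra.
  rewrite Rabs_pos_eq in HF0 |- * by lra. fold c.
  assert (0 <= Cmod (G z0)) by apply Cmod_ge_0. nra.
Qed.

(** The strict case applied to [t * phi], then [t] tends to [1]; this covers
    values of modulus [1] without a separate argument. *)
Lemma schwarz_pick (phi : C -> C) (z0 d : C) :
  smooth 4 phi -> (forall z, Cmod z < 1 -> Cmod (phi z) <= 1) ->
  Cmod z0 < 1 -> has_der phi z0 d ->
  Cmod d * (1 - Cmod z0 ^ 2) <= 1 - Cmod (phi z0) ^ 2.
Proof.
  intros Hphi Hb Hz0 Hd.
  assert (Hlim : - 1 <= - (1 * (Cmod d * (1 - Cmod z0 ^ 2)) + (1 * Cmod (phi z0)) ^ 2)); [|lra].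
  apply (limit_left_1
    (fun t => - (t * (Cmod d * (1 - Cmod z0 ^ 2)) + (t * Cmod (phi z0)) ^ 2)) _ 0 Rlt_0_1).
  - auto_derive. exact I.
  - intros t Ht. cbv beta.
    assert (H := schwarz_pick_strict (fun z => (t * phi z)%C) t z0 (t * d)%C).
    cbv beta in H. rewrite !Cmod_mult, Cmod_R, Rabs_pos_eq in H by lra.
    enough (t * Cmod d * (1 - Cmod z0 ^ 2) <= 1 - (t * Cmod (phi z0)) ^ 2) by lra.
    apply H; [lra| | |exact Hz0|].
    + intros z Hz. apply taylor_mult; [apply taylor_const|apply Hphi, Hz].
    + intros z Hz. rewrite Cmod_mult, Cmod_R, Rabs_pos_eq by lra.
      specialize (Hb z Hz). nra.
    + replace (t * d)%C with (0 * phi z0 + t * d)%C by ring.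
      apply (has_der_mult (fun _ => RtoC t) phi); [apply has_der_const|exact Hd].
Qed.

(** * Logarithmic derivatives of functions with positive real part *)

(** The witness [S] is the sum of [r^(2k)] over [k < n].  The last bound is
    [r^(2k+1) + r^(2(n-1-k)+1) <= 1 + r^(2n)], summed over [k]. *)
Lemma geometric_sum_bounds (r : R) (n : nat) : 0 <= r < 1 ->
  exists S, (1 - r ^ 2) * S = 1 - (r ^ n) ^ 2 /\ INR n * (r ^ n) ^ 2 <= S <= INR n /\
    2 * r * S <= INR n * (1 + (r ^ n) ^ 2).
Proof.
  intros Hr. induction n as [|n [S [H1 [[H2 H3] H4]]]].
  - exists 0. simpl. repeat split; lra.
  - exists (S + (r ^ n) ^ 2). rewrite S_INR. simpl (r ^ _).
    set (p := r ^ n) in *. set (N := INR n) in *.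
    assert (Hp : 0 <= p <= 1).
    { unfold p. split; [apply pow_le; lra|]. rewrite <- (pow1 n). apply pow_incr. lra. }
    assert (HN : 0 <= N) by apply pos_INR.
    assert (Hq : 0 <= p ^ 2 <= 1) by nra.
    assert (Hr2 : 0 <= r ^ 2 <= 1) by nra.
    assert (E : (r * p) ^ 2 = r ^ 2 * p ^ 2) by ring. rewrite E.
    repeat split.
    + lra.
    + assert (N * (r ^ 2 * p ^ 2) <= N * p ^ 2) by (apply Rmult_le_compat_l; nra). nra.
    + lra.
    + (* [1 - p^2 = (1 - r^2) S >= (1 - r^2) N p^2] *)
      assert (H5 : (1 - r ^ 2) * (N * p ^ 2) <= 1 - p ^ 2).
      { rewrite <- H1. apply Rmult_le_compat_l; lra. }
      assert (0 <= p ^ 2 * (1 - r) ^ 2) by (apply Rmult_le_pos; [lra|apply pow2_ge_0]).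
      nra.
Qed.

(** Here [r = |z|], [x = |phi z|] and [e = |phi' z|].  Inserting the largest
    [e] allowed by Schwarz-Pick leaves a ratio of the two sides that is
    largest at [x = 1], the case of the extremal [omega = z^n]. *)
Lemma schwarz_pick_majorant (n : nat) (r x e : R) :
  0 <= r < 1 -> 0 <= x <= 1 -> e * (1 - r ^ 2) <= 1 - x ^ 2 ->
  (INR n * r ^ n * x + r * r ^ n * e) * (1 - (r ^ n) ^ 2)
    <= INR n * r ^ n * (1 - (r ^ n * x) ^ 2).
Proof.
  intros Hr Hx He.
  destruct (geometric_sum_bounds r n Hr) as [S [H1 [[H2 H3] H4]]].
  assert (HN : 0 <= INR n) by apply pos_INR.
  assert (Hp : 0 <= r ^ n) by (apply pow_le; lra).
  set (p := r ^ n) in *. set (N := INR n) in *.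
  assert (Hp2 : 0 <= p ^ 2) by apply pow2_ge_0.
  assert (HS : 0 <= S) by nra.
  replace ((N * p * x + r * p * e) * (1 - p ^ 2))
    with (p * (N * x * (1 - p ^ 2) + r * e * (1 - p ^ 2))) by ring.
  replace (N * p * (1 - (p * x) ^ 2)) with (p * (N * (1 - p ^ 2 * x ^ 2))) by ring.
  apply Rmult_le_compat_l; [exact Hp|].
  assert (A : r * e * (1 - p ^ 2) <= r * S * (1 - x ^ 2)).
  { rewrite <- H1. replace (r * e * ((1 - r ^ 2) * S)) with (r * S * (e * (1 - r ^ 2))) by ring.
    apply Rmult_le_compat_l; [apply Rmult_le_pos; lra|exact He]. }
  (* affine in [x]: enough at [x = 0] and [x = 1] *)
  assert (B : r * S * (1 + x) <= N * (1 + p ^ 2 * x)).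
  { assert (r * S <= N) by nra. nra. }
  assert (Cx : r * S * (1 - x ^ 2) <= N * (1 + p ^ 2 * x) * (1 - x)).
  { replace (r * S * (1 - x ^ 2)) with (r * S * (1 + x) * (1 - x)) by ring.
    apply Rmult_le_compat_r; lra. }
  nra.
Qed.

Lemma Cmod_minus_plus_1 (p : C) : Cmod (p + 1) ^ 2 - Cmod (p - 1) ^ 2 = 4 * Re p.
Proof. rewrite !Cmod2_alt. destruct p as [a b]. simpl. ring. Qed.

(** The Cayley transform [omega = (p - 1) / (p + 1)] vanishes to
    order [n], so [omega = z^n phi] with [|phi| <= 1] by Schwarz's lemma.
    Then [z p' / Re p] has modulus [2 |z omega'| / (1 - |omega|^2)], and
    [z omega' = n z^n phi + z^(n+1) phi'] is bounded by applying the
    Schwarz-Pick inequality to [phi]. *)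
Lemma positive_real_part_der (n : nat) (p : C -> C) (c : nat -> C) (z d : C) :
  geom_bounded c -> (forall k, (k < n)%nat -> c k = 0%C) ->
  (forall z, Cmod z < 1 -> p z = (1 + PS c z)%C) ->
  (forall z, Cmod z < 1 -> 0 < Re (p z)) ->
  Cmod z < 1 -> has_der p z d ->
  Cmod (z * d) * (1 - (Cmod z ^ n) ^ 2) <= 2 * INR n * Cmod z ^ n * Re (p z).
Proof.
  intros Hc Hc0 Hp Hpos Hz Hd.
  assert (Hps : forall m, smooth m p).
  { intros m y Hy. apply (taylor_ext m (fun y => (1 + PS c y)%C)).
    - generalize (near_disk 1 y Hy). apply near_mono. intros x Hx. symmetry. apply Hp, Hx.
    - apply taylor_plus; [apply taylor_const|apply PS_taylor; assumption]. }
  assert (Hp1 : forall y, Cmod y < 1 -> (p y + 1)%C <> 0%C).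
  { intros y Hy E. specialize (Hpos y Hy).
    assert (E' : Re (p y + 1) = 0) by (rewrite E; reflexivity).
    simpl in E'. unfold Re in Hpos. lra. }
  set (w y := ((p y - 1) * / (p y + 1))%C).
  set (phi y := (PS (fun k => c (k + n)%nat) y * / (p y + 1))%C).
  assert (Hphi : forall m, smooth (S m) phi).
  { intros m y Hy. apply taylor_mult.
    - apply PS_taylor; [apply geom_bounded_shift, Hc|exact Hy].
    - apply (taylor_inv m (fun y => (p y + 1)%C)); [|apply Hp1, Hy].
      apply taylor_plus; [apply Hps, Hy|apply taylor_const]. }
  assert (Hw : forall y, Cmod y < 1 -> w y = (y ^ n * phi y)%C).
  { intros y Hy. unfold w, phi.
    replace (p y - 1)%C with (y ^ n * PS (fun k => c (k + n)%nat) y)%C; [ring|].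
    rewrite <- (PS_shift c n y Hc Hy Hc0), Hp by exact Hy. ring. }
  assert (Hw1 : forall y, Cmod y < 1 -> Cmod (w y) <= 1).
  { intros y Hy. unfold w. rewrite Cmod_mult, Cmod_inv by (apply Hp1, Hy).
    assert (H0 : 0 < Cmod (p y + 1)) by (apply Cmod_gt_0, Hp1, Hy).
    apply Rmult_le_reg_r with (Cmod (p y + 1)); [exact H0|].
    rewrite Rmult_assoc, Rinv_l, Rmult_1_r, Rmult_1_l by lra.
    apply Rsqr_incr_0_var; [|lra]. unfold Rsqr.
    assert (H1 := Cmod_minus_plus_1 (p y)). specialize (Hpos y Hy). lra. }
  assert (Hphi1 := schwarz n w phi (Hphi 2%nat) Hw Hw1).
  destruct (has_der_ex phi z (Hphi 1%nat z Hz)) as [e He].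
  assert (Hsp := schwarz_pick phi z e (Hphi 3%nat) Hphi1 Hz He).
  set (dw := ((INR n * z ^ (n - 1) * 1) * phi z + z ^ n * e)%C).
  assert (Hdw : has_der w z dw).
  { apply (has_der_ext (fun y => (y ^ n * phi y)%C)).
    - generalize (near_disk 1 z Hz). apply near_mono. intros y Hy. symmetry. apply Hw, Hy.
    - apply (has_der_mult (fun y => (y ^ n)%C) phi); [|exact He].
      apply (has_der_pow (fun y => y)). apply has_der_id. }
  (* differentiate [p = 1 + w (p + 1)] *)
  assert (Ed : d = (0 + (dw * (p z + 1) + w z * (d + 0)))%C).
  { apply (has_der_unique p z); [exact Hd|].
    apply (has_der_ext (fun y => (1 + w y * (p y + 1))%C)).
    - generalize (near_disk 1 z Hz). apply near_mono. intros y Hy. unfold w.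
      field. apply Hp1, Hy.
    - apply has_der_plus; [apply has_der_const|].
      apply (has_der_mult w (fun y => (p y + 1)%C)); [exact Hdw|].
      apply has_der_plus; [exact Hd|apply has_der_const]. }
  assert (Ed2 : (2 * d = dw * (p z + 1) ^ 2)%C).
  { assert (E : (d * (1 - w z) = dw * (p z + 1))%C).
    { transitivity (d - w z * d)%C; [ring|]. rewrite Ed at 1. ring. }
    transitivity ((d * (1 - w z)) * (p z + 1))%C; [|rewrite E; ring].
    unfold w. field. apply Hp1, Hz. }
  assert (Emod : 2 * Cmod (z * d) = Cmod (z * dw) * Cmod (p z + 1) ^ 2).
  { rewrite <- Cmod_pow, <- Cmod_mult.
    replace (z * dw * (p z + 1) ^ 2)%C with (2 * (z * d))%C.
    - rewrite (Cmod_mult 2 (z * d)), Cmod_R, Rabs_pos_eq; lra.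
    - transitivity (z * (2 * d))%C; [ring|]. rewrite Ed2. ring. }
  set (r := Cmod z) in *. set (x := Cmod (phi z)) in *.
  assert (Hr0 : 0 <= r) by apply Cmod_ge_0.
  assert (Hx0 : 0 <= x <= 1) by (split; [apply Cmod_ge_0|apply Hphi1, Hz]).
  assert (Hzdw : Cmod (z * dw) <= INR n * r ^ n * x + r * r ^ n * Cmod e).
  { unfold dw. replace (z * (INR n * z ^ (n - 1) * 1 * phi z + z ^ n * e))%C
      with (INR n * z ^ n * phi z + z * z ^ n * e)%C.
    - eapply Rle_trans; [apply Cmod_triangle|].
      rewrite !Cmod_mult, Cmod_R, !Cmod_pow, Rabs_pos_eq by apply pos_INR.
      apply Rle_refl.
    - destruct n as [|m]; [simpl; ring|].
      replace (S m - 1)%nat with m by lia. simpl (z ^ S m)%C. ring. }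
  assert (Hmaj := schwarz_pick_majorant n r x (Cmod e) (conj Hr0 Hz) Hx0 Hsp).
  assert (Hrn : 0 <= r ^ n <= 1).
  { split; [apply pow_le, Hr0|]. rewrite <- (pow1 n). apply pow_incr. lra. }
  assert (HR : Cmod (p z + 1) ^ 2 * (1 - (r ^ n * x) ^ 2) = 4 * Re (p z)).
  { rewrite <- Cmod_minus_plus_1.
    replace (r ^ n * x) with (Cmod (w z))
      by (rewrite Hw by exact Hz; rewrite Cmod_mult, Cmod_pow; reflexivity).
    unfold w. rewrite Cmod_mult, Cmod_inv by (apply Hp1, Hz). field.
    apply Rgt_not_eq, Cmod_gt_0, Hp1, Hz. }
  assert (HQ : 0 <= Cmod (p z + 1) ^ 2) by apply pow2_ge_0.
  set (Q := Cmod (p z + 1) ^ 2) in *.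
  assert (H1 : Cmod (z * dw) * (1 - (r ^ n) ^ 2) <= INR n * r ^ n * (1 - (r ^ n * x) ^ 2)).
  { eapply Rle_trans; [|exact Hmaj]. apply Rmult_le_compat_r; [nra|exact Hzdw]. }
  apply (Rmult_le_compat_r Q) in H1; [|exact HQ].
  apply Rmult_le_reg_l with 2; [lra|].
  replace (2 * (Cmod (z * d) * (1 - (r ^ n) ^ 2)))
    with (2 * Cmod (z * d) * (1 - (r ^ n) ^ 2)) by ring.
  rewrite Emod.
  replace (2 * (2 * INR n * r ^ n * Re (p z))) with (INR n * r ^ n * (4 * Re (p z))) by ring.
  rewrite <- HR. lra.
Qed.

(** * The estimate for close-to-starlike functions *)

Lemma starlike_halfplane_bound (alpha rho : R) (w : C) :
  alpha < 1 -> Cmod w <= rho < 1 ->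
  Re ((1 + RtoC (1 - 2 * alpha) * w) / (1 - w))%C
    <= (1 + (1 - 2 * alpha) * rho) / (1 - rho).
Proof.
  intros Ha [Hw Hr]. set (m := Cmod w) in *.
  assert (Hm : 0 <= m) by apply Cmod_ge_0.
  assert (Hm2 : m ^ 2 = Re w ^ 2 + Im w ^ 2) by apply Cmod2_alt.
  assert (Hx : Re w <= m).
  { eapply Rle_trans; [apply Rle_abs|apply re_le_Cmod]. }
  clearbody m. destruct w as [x y]. unfold Re, Im in Hm2, Hx. cbn [fst snd] in Hm2, Hx.
  assert (Hx1 : 0 < 1 - x) by lra.
  assert (HQ : 0 < (1 - x) ^ 2 + y ^ 2) by nra.
  set (Q := (1 - x) ^ 2 + y ^ 2) in *.
  replace (Re ((1 + RtoC (1 - 2 * alpha) * (x, y)) / (1 - (x, y)))%C)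
    with (alpha + (1 - alpha) * ((1 - m ^ 2) / Q)).
  - replace ((1 + (1 - 2 * alpha) * rho) / (1 - rho))
      with (alpha + (1 - alpha) * ((1 + rho) / (1 - rho))) by (field; lra).
    apply Rplus_le_compat_l, Rmult_le_compat_l; [lra|].
    apply Rmult_le_reg_r with (Q * (1 - rho)); [apply Rmult_lt_0_compat; lra|].
    replace ((1 - m ^ 2) / Q * (Q * (1 - rho))) with ((1 - m ^ 2) * (1 - rho))
      by (field; lra).
    replace ((1 + rho) / (1 - rho) * (Q * (1 - rho))) with ((1 + rho) * Q) by (field; lra).
    (* the difference is at least [2 (rho - m) (1 - m)] *)
    assert (E : (1 + rho) * Q - (1 - m ^ 2) * (1 - rho)
      = 2 * (rho - x * (1 + rho) + m ^ 2)) by (unfold Q; rewrite Hm2; ring).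
    assert (0 <= (rho - m) * (1 - m)) by (apply Rmult_le_pos; lra).
    assert (x * (1 + rho) <= m * (1 + rho)) by (apply Rmult_le_compat_r; lra).
    nra.
  - rewrite Hm2. unfold Cdiv, Cinv, Cminus, Cplus, Copp, Cmult, RtoC, Re, Q. simpl.
    field. unfold Q in HQ. repeat split; apply Rgt_not_eq; nra.
Qed.

(** In [g(z) = z + ...] both [z g' - g] and [z g' + (1 - 2 alpha) g] are
    explicit power series, and the first is divisible by [z^(n+1)].  Hence
    the subordinating function is [z^n] times a quotient of power series
    and Schwarz's lemma of order [n] applies to it. *)
Lemma starlike_estimate (n : nat) (alpha : R) (g : C -> C) (z : C) :
  (1 <= n)%nat -> alpha < 1 -> classST n alpha g -> Cmod z < 1 ->
  Re (zlogder g z) <= (1 + (1 - 2 * alpha) * Cmod z ^ n) / (1 - Cmod z ^ n).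
Proof.
  intros Hn Ha [[_ [a [Ha0 Hga]]] [Hnv [_ [w [_ [Hw0 Hsub]]]]]] Hz.
  destruct (pseries_geom_bounded a _ Hga) as [Ga Hg]. cbv beta in Hg. clear Hga.
  set (k1 := RtoC (1 - 2 * alpha)).
  set (b1 k := (INR k * a k + (- (1)) * a k)%C).
  set (b2 k := (INR k * a k + k1 * a k)%C).
  assert (G1 : geom_bounded b1).
  { apply geom_bounded_plus; [apply geom_bounded_INR, Ga|apply geom_bounded_scal, Ga]. }
  assert (G2 : geom_bounded b2).
  { apply geom_bounded_plus; [apply geom_bounded_INR, Ga|apply geom_bounded_scal, Ga]. }
  set (A := PS (fun k => b1 (k + S n)%nat)).
  set (B y := ((1 + k1) + PS (fun k => b2 (k + 1)%nat) y)%C).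
  assert (Hder : forall y, Cmod y < 1 -> (y * C_derive g y = y + PS (fun k => INR k * a k)%C y)%C).
  { intros y Hy.
    rewrite (has_der_C_derive g y (1 + PS (fun k => (INR (S k) * a (S k))%C) y)).
    - rewrite <- PS_euler by assumption. ring.
    - apply (has_der_ext (fun x => (x + PS a x)%C)).
      + generalize (near_disk 1 y Hy). apply near_mono. intros x Hx.
        rewrite <- Hg by exact Hx. ring.
      + apply has_der_plus; [apply has_der_id|apply PS_has_der; assumption]. }
  assert (HA : forall y, Cmod y < 1 -> (y * C_derive g y - g y = y ^ S n * A y)%C).
  { intros y Hy. unfold A. rewrite <- (PS_shift b1 (S n) y G1 Hy).
    - unfold b1. rewrite (PS_add_coef (fun k => INR k * a k)%C (fun k => - (1) * a k)%C),
        (PS_scal_coef _ a);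
        auto using geom_bounded_INR, geom_bounded_scal.
      rewrite Hder, <- Hg by exact Hy. ring.
    - intros k Hk. unfold b1. rewrite Ha0 by lia. ring. }
  assert (HB : forall y, Cmod y < 1 -> (y * C_derive g y + k1 * g y = y * B y)%C).
  { intros y Hy.
    assert (E := PS_shift b2 1 y G2 Hy).
    assert (E0 : PS b2 y = (PS (fun k => INR k * a k)%C y + k1 * PS a y)%C).
    { unfold b2. rewrite (PS_add_coef (fun k => INR k * a k)%C (fun k => k1 * a k)%C),
        (PS_scal_coef _ a); auto using geom_bounded_INR, geom_bounded_scal. }
    rewrite E0, <- Hg in E by exact Hy.
    rewrite Hder by exact Hy. unfold B.
    transitivity ((1 + k1) * y + y ^ 1 * PS (fun k => b2 (k + 1)%nat) y)%C; [|simpl; ring].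
    rewrite <- E; [ring|].
    intros k Hk. replace k with 0%nat by lia. unfold b2. rewrite Ha0 by lia. ring. }
  assert (Hw1 : forall y, Cmod y < 1 -> (1 - w y)%C <> 0%C).
  { intros y Hy E. destruct (Hsub y Hy) as [H _].
    replace (w y) with (1 - (1 - w y))%C in H by ring. rewrite E in H.
    replace (1 - 0)%C with (RtoC 1) in H by ring. rewrite Cmod_1 in H. lra. }
  assert (Hk1 : (1 + k1)%C <> 0%C).
  { unfold k1. rewrite <- RtoC_plus. intros E. apply RtoC_inj in E. lra. }
  assert (Hq : forall y, Cmod y < 1 -> y <> 0%C ->
    (y * C_derive g y = g y * ((1 + k1 * w y) / (1 - w y)))%C).
  { intros y Hy Hy0. destruct (Hsub y Hy) as [_ E].
    unfold zlogder, one_at_0 in E. destruct (Ceq_dec y 0) as [|_]; [contradiction|].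
    fold k1 in E. rewrite <- E. field. apply Hnv; assumption. }
  assert (HB0 : forall y, Cmod y < 1 -> B y <> 0%C).
  { intros y Hy E. destruct (Ceq_dec y 0) as [->|Hy0].
    - revert E. unfold B. rewrite PS_0 by (apply geom_bounded_shift, G2).
      unfold b2. simpl (0 + 1)%nat. rewrite Ha0 by lia.
      replace (1 + k1 + (INR 1 * 0 + k1 * 0))%C with (1 + k1)%C by ring. exact Hk1.
    - assert (E' := HB y Hy). rewrite E, Hq in E' by assumption.
      assert (E2 : (g y * (1 + k1) = 0)%C).
      { transitivity ((g y * ((1 + k1 * w y) / (1 - w y)) + k1 * g y) * (1 - w y))%C.
        - field. apply Hw1, Hy.
        - rewrite E'. ring. }
      revert E2. apply Cmult_neq_0; [apply Hnv; assumption|exact Hk1]. }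
  set (phi y := (A y * / B y)%C).
  assert (Hphi : smooth 3 phi).
  { intros y Hy. apply taylor_mult.
    - apply PS_taylor; [apply geom_bounded_shift, G1|exact Hy].
    - apply (taylor_inv 2 B); [|apply HB0, Hy].
      apply taylor_plus; [apply taylor_const|].
      apply PS_taylor; [apply geom_bounded_shift, G2|exact Hy]. }
  assert (Hw : forall y, Cmod y < 1 -> w y = (y ^ n * phi y)%C).
  { intros y Hy. destruct (Ceq_dec y 0) as [->|Hy0].
    - rewrite Hw0. destruct n as [|m]; [lia|]. simpl. ring.
    - assert (E : (w y * (y * B y) = y ^ S n * A y)%C).
      { rewrite <- HA, <- HB, Hq by assumption. field. apply Hw1, Hy. }
      unfold phi. assert (HBy := HB0 y Hy).
      transitivity ((w y * (y * B y)) * / (y * B y))%C; [field; auto|].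
      rewrite E. simpl (y ^ S n)%C. field. auto. }
  assert (Hphi1 := schwarz n w phi Hphi Hw
    (fun y Hy => Rlt_le _ _ (proj1 (Hsub y Hy))) z Hz).
  destruct (Hsub z Hz) as [Hwz ->].
  assert (H0 : 0 <= Cmod z) by apply Cmod_ge_0.
  assert (Hrn : 0 <= Cmod z ^ n) by (apply pow_le, H0).
  apply starlike_halfplane_bound; [exact Ha|]. split.
  - rewrite Hw, Cmod_mult, Cmod_pow by exact Hz.
    rewrite <- (Rmult_1_r (Cmod z ^ n)) at 2. apply Rmult_le_compat_l; assumption.
  - destruct n as [|m]; [lia|]. simpl.
    assert (Cmod z ^ m <= 1) by (rewrite <- (pow1 m); apply pow_incr; lra).
    assert (0 <= Cmod z ^ m) by (apply pow_le, H0). nra.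
Qed.

(** The value of [z f'(z) / f(z)] for the extremal function at a positive
    [z] with [z^n = rho]: the first term comes from the starlike factor, the
    second from the factor of positive real part. *)
Definition CS_majorant (n : nat) (alpha rho : R) : R :=
  (1 + (1 - 2 * alpha) * rho) / (1 - rho) + 2 * INR n * rho / (1 - rho ^ 2).

Lemma close_to_starlike_nonvanishing (n : nat) (alpha : R) (f : C -> C) :
  classCS n alpha f -> nonvanishing 1 f.
Proof.
  intros [_ [g [[_ [Hnv _]] [_ [_ Hpos]]]]] z Hz Hz0 E.
  specialize (Hpos z Hz). unfold one_at_0 in Hpos.
  destruct (Ceq_dec z 0) as [|_]; [contradiction|].
  rewrite E in Hpos. replace (0 / g z)%C with (RtoC 0) in Hpos
    by (field; apply Hnv; assumption).
  simpl in Hpos. lra.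
Qed.

Lemma close_to_starlike_estimate (n : nat) (alpha : R) (f : C -> C) (z : C) :
  (1 <= n)%nat -> alpha < 1 -> classCS n alpha f -> Cmod z < 1 -> z <> 0%C ->
  Re (zlogder f z) <= CS_majorant n alpha (Cmod z ^ n).
Proof.
  intros Hn Ha [_ [g [HST HP]]] Hz Hz0.
  assert (Hs := starlike_estimate n alpha g z Hn Ha HST Hz).
  destruct HST as [[_ [a [_ Hga]]] [Hnv _]].
  destruct (pseries_geom_bounded a _ Hga) as [Ga Hg]. cbv beta in Hg. clear Hga.
  set (p := one_at_0 (fun z => (f z / g z)%C)) in *.
  destruct HP as [_ [[c [Hc0 Hpc]] Hpos]].
  destruct (pseries_geom_bounded c _ Hpc) as [Gc Hp]. cbv beta in Hp. clear Hpc.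
  assert (Hp' : forall y, Cmod y < 1 -> p y = (1 + PS c y)%C).
  { intros y Hy. rewrite <- Hp by exact Hy. ring. }
  assert (Dg : exists e, has_der g z e).
  { eexists. apply (has_der_ext (fun x => (x + PS a x)%C)).
    - generalize (near_disk 1 z Hz). apply near_mono. intros x Hx.
      rewrite <- Hg by exact Hx. ring.
    - apply has_der_plus; [apply has_der_id|apply PS_has_der; assumption]. }
  assert (Dp : exists d, has_der p z d).
  { eexists. apply (has_der_ext (fun x => (1 + PS c x)%C)).
    - generalize (near_disk 1 z Hz). apply near_mono. intros x Hx.
      symmetry. apply Hp', Hx.
    - apply has_der_plus; [apply has_der_const|apply PS_has_der; assumption]. }
  destruct Dg as [e De]. destruct Dp as [d Dd].
  assert (Hfg : forall y, Cmod y < 1 -> y <> 0%C -> f y = (g y * p y)%C).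
  { intros y Hy Hy0. unfold p, one_at_0. destruct (Ceq_dec y 0); [contradiction|].
    field. apply Hnv; assumption. }
  assert (Df : C_derive f z = (e * p z + g z * d)%C).
  { apply has_der_C_derive. apply (has_der_ext (fun y => (g y * p y)%C)).
    - generalize (near_and _ _ _ (near_disk 1 z Hz) (near_neq z 0 Hz0)).
      apply near_mono. intros y [Hy Hy0]. symmetry. apply Hfg; assumption.
    - apply has_der_mult; assumption. }
  assert (Hpz := Hpos z Hz). 
  assert (Hpz0 : p z <> 0%C).
  { intros E. rewrite E in Hpz. simpl in Hpz. lra. }
  assert (Hgz : g z <> 0%C) by (apply Hnv; assumption).
  assert (Ez : zlogder f z = (zlogder g z + z * d / p z)%C).
  { unfold zlogder, one_at_0. destruct (Ceq_dec z 0) as [|_]; [contradiction|].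
    rewrite Df, (has_der_C_derive _ _ _ De), Hfg by assumption. field. auto. }
  rewrite Ez, re_plus. unfold CS_majorant. apply Rplus_le_compat; [exact Hs|].
  assert (Hest := positive_real_part_der n p c z d Gc Hc0 Hp' Hpos Hz Dd).
  set (rho := Cmod z ^ n) in *.
  assert (Hrho : 0 <= rho < 1).
  { unfold rho. split; [apply pow_le, Cmod_ge_0|].
    destruct n as [|m]; [lia|]. simpl.
    assert (H0 := Cmod_ge_0 z).
    assert (Cmod z ^ m <= 1) by (rewrite <- (pow1 m); apply pow_incr; lra).
    assert (0 <= Cmod z ^ m) by (apply pow_le, H0). nra. }
  eapply Rle_trans; [apply Rle_abs|]. eapply Rle_trans; [apply re_le_Cmod|].
  rewrite Cmod_div by exact Hpz0.
  assert (Hre : Re (p z) <= Cmod (p z)).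
  { eapply Rle_trans; [apply Rle_abs|apply re_le_Cmod]. }
  assert (Hr2 : 0 < 1 - rho ^ 2) by nra.
  assert (HN : 0 <= INR n) by apply pos_INR.
  apply Rmult_le_reg_r with (Cmod (p z) * (1 - rho ^ 2)); [apply Rmult_lt_0_compat; lra|].
  replace (Cmod (z * d) / Cmod (p z) * (Cmod (p z) * (1 - rho ^ 2)))
    with (Cmod (z * d) * (1 - rho ^ 2)) by (field; lra).
  replace (2 * INR n * rho / (1 - rho ^ 2) * (Cmod (p z) * (1 - rho ^ 2)))
    with (2 * INR n * rho * Cmod (p z)) by (field; lra).
  eapply Rle_trans; [exact Hest|]. apply Rmult_le_compat_l; [|exact Hre].
  apply Rmult_le_pos; lra.
Qed.

(** * The critical radius *)

Definition critical_rho (n : nat) (alpha beta : R) : R :=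
  (beta - 1) /
    ((1 + INR n - alpha) +
     sqrt ((1 + INR n - alpha) ^ 2 + (beta - 1) * (1 + beta - 2 * alpha))).

(** Clearing denominators in [CS_majorant n alpha rho = beta] gives this
    quadratic equation; rationalising its positive root yields the stated
    formula. *)
Lemma critical_rho_root (n : nat) (alpha beta : R) :
  0 <= alpha < 1 -> 1 < beta -> 
  let rho := critical_rho n alpha beta in
  0 < rho < 1 /\
  (1 + beta - 2 * alpha) * rho ^ 2 + 2 * (1 + INR n - alpha) * rho = beta - 1.
Proof.
  intros Ha Hb. cbv zeta. unfold critical_rho.
  assert (HN : 0 <= INR n) by apply pos_INR.
  set (b := 1 + INR n - alpha). set (K := 1 + beta - 2 * alpha).
  assert (Hbp : 0 < b) by (unfold b; lra).
  assert (HK : 0 < K) by (unfold K; lra).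
  set (s := sqrt (b ^ 2 + (beta - 1) * K)).
  assert (HD : 0 < b ^ 2 + (beta - 1) * K).
  { apply Rplus_lt_0_compat; [apply pow_lt, Hbp|apply Rmult_lt_0_compat; lra]. }
  assert (Hs : 0 < s) by (apply sqrt_lt_R0, HD).
  assert (Hs2 : s * s = b ^ 2 + (beta - 1) * K) by (apply sqrt_sqrt; lra).
  set (rho := (beta - 1) / (b + s)).
  assert (Hr : 0 < rho) by (apply Rdiv_lt_0_compat; lra).
  assert (E : K * rho ^ 2 + 2 * b * rho = beta - 1).
  { assert (E1 : K * rho ^ 2 + 2 * b * rho - (beta - 1)
      = (beta - 1) * (b ^ 2 + (beta - 1) * K - s * s) / (b + s) ^ 2)
      by (unfold rho; field; lra).
    rewrite Hs2 in E1. unfold Rdiv in E1. lra. }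
  split; [|exact E]. split; [exact Hr|]. apply Rnot_le_lt. intros H1.
  assert (K * 1 <= K * rho ^ 2) by (apply Rmult_le_compat_l; nra).
  assert (2 * b * 1 <= 2 * b * rho) by (apply Rmult_le_compat_l; lra).
  unfold K, b in *. lra.
Qed.

Lemma CS_majorant_minus (n : nat) (alpha beta rho : R) : 0 <= rho < 1 ->
  (beta - CS_majorant n alpha rho) * (1 - rho ^ 2) = (beta - 1) -
    ((1 + beta - 2 * alpha) * rho ^ 2 + 2 * (1 + INR n - alpha) * rho).
Proof. intros Hr. unfold CS_majorant. field. split; nra. Qed.

Lemma CS_majorant_lt (n : nat) (alpha beta rho : R) :
  0 <= alpha < 1 -> 1 < beta -> 0 <= rho < critical_rho n alpha beta ->
  CS_majorant n alpha rho < beta.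
Proof.
  intros Ha Hb Hr. destruct (critical_rho_root n alpha beta Ha Hb) as [H0 E].
  set (rho0 := critical_rho n alpha beta) in *.
  assert (HN : 0 <= INR n) by apply pos_INR.
  assert (Em := CS_majorant_minus n alpha beta rho ltac:(lra)).
  assert (rho ^ 2 < rho0 ^ 2) by nra.
  assert ((1 + beta - 2 * alpha) * rho ^ 2 < (1 + beta - 2 * alpha) * rho0 ^ 2)
    by (apply Rmult_lt_compat_l; lra).
  assert (2 * (1 + INR n - alpha) * rho < 2 * (1 + INR n - alpha) * rho0)
    by (apply Rmult_lt_compat_l; lra).
  assert (0 < 1 - rho ^ 2) by nra. nra.
Qed.

Lemma CS_majorant_critical (n : nat) (alpha beta : R) :
  0 <= alpha < 1 -> 1 < beta ->
  CS_majorant n alpha (critical_rho n alpha beta) = beta.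
Proof.
  intros Ha Hb. destruct (critical_rho_root n alpha beta Ha Hb) as [H0 E].
  assert (Em := CS_majorant_minus n alpha beta _ (conj (Rlt_le _ _ (proj1 H0)) (proj2 H0))).
  rewrite E, Rminus_diag in Em. apply Rmult_integral in Em. destruct Em; nra.
Qed.

Lemma pow_lt_compat (x y : R) (n : nat) : (1 <= n)%nat -> 0 <= x < y -> x ^ n < y ^ n.
Proof.
  intros Hn Hxy. destruct n as [|m]; [lia|]. simpl.
  assert (x ^ m <= y ^ m) by (apply pow_incr; lra).
  assert (0 < y ^ m) by (apply pow_lt; lra). nra.
Qed.

Lemma Rpower_root_pow (n : nat) (x : R) : (1 <= n)%nat -> 0 < x < 1 ->
  Rpower x (/ INR n) ^ n = x /\ 0 < Rpower x (/ INR n) < 1.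
Proof.
  intros Hn Hx. assert (HN : 0 < INR n) by (apply lt_0_INR; lia).
  assert (Hp : 0 < Rpower x (/ INR n)) by apply exp_pos.
  assert (E : Rpower x (/ INR n) ^ n = x).
  { rewrite <- Rpower_pow by exact Hp. rewrite Rpower_mult, Rinv_l by lra.
    apply Rpower_1. lra. }
  split; [exact E|]. split; [exact Hp|]. apply Rnot_le_lt. intros H.
  assert (H1 := pow_R1_Rle _ n H). lra.
Qed.

(** * Binomial series *)

Fixpoint binomial_coef (delta : R) (k : nat) : R :=
  match k with
  | O => 1
  | S j => binomial_coef delta j * (delta + INR j) / INR (S j)
  end.

Lemma eventually_decreasing_bounded (u : nat -> R) (K : nat) :
  (forall k, (K <= k)%nat -> u (S k) <= u k) -> exists M, forall k, u k <= M.
Proof.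
  revert u. induction K as [|K IH]; intros u H.
  - exists (u 0%nat). induction k as [|k IHk]; [lra|].
    eapply Rle_trans; [apply H; lia|exact IHk].
  - destruct (IH (fun k => u (S k))) as [M HM].
    { intros k Hk. apply H. lia. }
    exists (Rmax (u 0%nat) M). intros [|k]; [apply Rmax_l|].
    eapply Rle_trans; [apply HM|apply Rmax_r].
Qed.

Lemma geom_bounded_binomial (delta : R) :
  geom_bounded (fun k => RtoC (binomial_coef delta k)).
Proof.
  intros rho Hr.
  assert (HK : exists K, Rabs delta <= INR K * (1 - rho)).
  { destruct (INR_unbounded (Rabs delta / (1 - rho))) as [K HK]. exists K.
    apply Rmult_le_reg_r with (/ (1 - rho)); [apply Rinv_0_lt_compat; lra|].
    rewrite Rmult_assoc, Rinv_r, Rmult_1_r by lra. left. exact HK. }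
  destruct HK as [K HK].
  apply (eventually_decreasing_bounded
    (fun k => Cmod (RtoC (binomial_coef delta k)) * rho ^ k) K).
  intros k Hk. rewrite !Cmod_R.
  change (binomial_coef delta (S k))
    with (binomial_coef delta k * (delta + INR k) / INR (S k)).
  unfold Rdiv. rewrite !Rabs_mult. simpl (rho ^ S k).
  assert (H1 : 0 < INR (S k)) by (apply lt_0_INR; lia).
  rewrite (Rabs_pos_eq (/ INR (S k))) by (left; apply Rinv_0_lt_compat, H1).
  assert (Hk0 : 0 <= INR k) by apply pos_INR.
  assert (H2 : Rabs (delta + INR k) <= Rabs delta + INR k).
  { eapply Rle_trans; [apply Rabs_triang|]. rewrite (Rabs_pos_eq (INR k)); lra. }
  assert (H3 : INR K <= INR k) by (apply le_INR, Hk).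
  assert (H4 : INR K * (1 - rho) <= INR k * (1 - rho)) by (apply Rmult_le_compat_r; lra).
  assert (H5 : Rabs (delta + INR k) * rho <= INR (S k)).
  { rewrite S_INR. assert (0 <= Rabs delta) by apply Rabs_pos.
    assert (0 <= Rabs (delta + INR k)) by apply Rabs_pos. nra. }
  replace (Rabs (binomial_coef delta k) * Rabs (delta + INR k) * / INR (S k) * (rho * rho ^ k))
    with ((Rabs (binomial_coef delta k) * rho ^ k) * (Rabs (delta + INR k) * rho * / INR (S k)))
    by ring.
  rewrite <- (Rmult_1_r (Rabs (binomial_coef delta k) * rho ^ k)) at 2.
  apply Rmult_le_compat_l.
  - apply Rmult_le_pos; [apply Rabs_pos|apply pow_le; lra].
  - apply Rmult_le_reg_r with (INR (S k)); [exact H1|].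
    rewrite Rmult_assoc, Rinv_l, Rmult_1_r, Rmult_1_l by lra. exact H5.
Qed.

(** The sum of the binomial series, that is [(1 - x)^(-delta)]. *)
Definition binomial_series (delta : R) : C -> C :=
  PS (fun k => RtoC (binomial_coef delta k)).

(** The differential equation [(1 - x) y' = delta y], multiplied by [x] so
    that it only involves the Euler operator. *)
Lemma binomial_euler (delta : R) (x : C) : Cmod x < 1 ->
  ((1 - x) * PS (fun k => INR k * RtoC (binomial_coef delta k))%C x
    = delta * x * binomial_series delta x)%C.
Proof.
  intros Hx. unfold binomial_series.
  assert (G := geom_bounded_binomial delta).
  set (a := fun k => RtoC (binomial_coef delta k)) in *.
  assert (GI := geom_bounded_INR a G).
  change ((1 - x) * PS (fun k => INR k * a k) x = delta * x * PS a x)%C.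
  assert (E : PS (fun k => INR (S k) * a (S k))%C x
     = (PS (fun k => INR k * a k)%C x + delta * PS a x)%C).
  { rewrite <- PS_scal_coef, <- PS_add_coef by (auto using geom_bounded_scal).
    apply PS_ext_coef. intros k. unfold a.
    change (binomial_coef delta (S k))
      with (binomial_coef delta k * (delta + INR k) / INR (S k)).
    rewrite <- !RtoC_mult, <- RtoC_plus. f_equal. field.
    apply not_0_INR. lia. }
  assert (E2 := PS_euler a x G Hx). rewrite E in E2.
  transitivity (PS (fun k => INR k * a k)%C x - x * PS (fun k => INR k * a k)%C x)%C; [ring|].
  rewrite <- E2 at 1. ring.
Qed.

(** The real and imaginary parts have zero derivative along the segment from
    the origin. *)
Lemma has_der_0_constant (F : C -> C) (z : C) :
  (forall y, Cmod y < 1 -> has_der F y 0) -> Cmod z < 1 -> F z = F 0%C.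
Proof.
  intros HF Hz.
  assert (H : forall h : C -> R, (forall x y, Rabs (h x - h y) <= Cmod (x - y)) ->
    h (F z) = h (F 0%C)).
  { intros h Hh.
    assert (E : h (F (0 * z)%C) = h (F (1 * z)%C)).
    { apply (eq_is_derive (V := R_NormedModule) (fun t : R => h (F (t * z)%C)) 0 1); [|lra].
      intros t Ht. assert (Htz : Cmod (t * z) < 1).
      { rewrite Cmod_mult, Cmod_R, Rabs_pos_eq by lra.
        assert (0 <= Cmod z) by apply Cmod_ge_0. nra. }
      destruct (HF _ Htz) as [f1 [T [E0 H1]]].
      split; [apply is_linear_scal_l|]. intros x Hx.
      assert (x = t).
      { symmetry. apply (is_filter_lim_locally_unique (V := R_NormedModule)). exact Hx. }
      subst x. clear Hx. intros eps.
      destruct (near_and _ _ _ H1 (taylor_1_continuous f1 _ eps T (cond_pos eps)))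
        as [d [Hd Hn]].
      exists (mkposreal d Hd). intros s Hs.
      change (Rabs (s - t) < d) in Hs.
      change (Rabs (h (F (s * z)%C) - h (F (t * z)%C) - (s - t) * 0) <= eps * Rabs (s - t)).
      replace (h (F (s * z)%C) - h (F (t * z)%C) - (s - t) * 0)
        with (h (F (s * z)%C) - h (F (t * z)%C)) by ring.
      eapply Rle_trans; [apply Hh|].
      assert (Hst : Cmod (s * z - t * z) <= Rabs (s - t)).
      { replace (s * z - t * z)%C with (RtoC (s - t) * z)%C by (rewrite RtoC_minus; ring).
        rewrite Cmod_mult, Cmod_R. assert (0 <= Rabs (s - t)) by apply Rabs_pos. nra. }
      destruct (Hn (s * z)%C ltac:(lra)) as [E1 E2].
      rewrite E0 in E2. replace (f1 (s * z) - 0)%C with (f1 (s * z)%C) in E2 by ring.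
      rewrite E1. replace (F (t * z) + (s * z - t * z) * f1 (s * z) - F (t * z))%C
        with (f1 (s * z) * (s * z - t * z))%C by ring.
      rewrite Cmod_mult. apply Rmult_le_compat; try apply Cmod_ge_0; lra. }
    replace (0 * z)%C with (RtoC 0) in E by ring.
    replace (1 * z)%C with z in E by ring. symmetry. exact E. }
  apply injective_projections.
  - apply (H Re). intros x y. eapply Rle_trans; [|apply re_le_Cmod]. right.
    f_equal.
  - apply (H Im). intros x y. eapply Rle_trans; [|apply Im_le_Cmod]. right.
    f_equal.
Qed.

(** The series of exponents [delta] and [-delta] are inverse to each other:
    by [binomial_euler] their product has derivative zero. *)
Lemma binomial_series_neq_0 (delta : R) (x : C) : Cmod x < 1 ->
  binomial_series delta x <> 0%C.
Proof.
  intros Hx E0.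
  assert (G := geom_bounded_binomial).
  assert (E : (binomial_series delta x * binomial_series (- delta) x)%C =
    (binomial_series delta 0 * binomial_series (- delta) 0)%C).
  { apply (has_der_0_constant (fun y => binomial_series delta y * binomial_series (- delta) y)%C);
      [|exact Hx].
    assert (D : forall e y, Cmod y < 1 -> exists d, has_der (binomial_series e) y d /\
      ((1 - y) * d = e * binomial_series e y)%C).
    { intros e y Hy.
      exists (PS (fun k => (INR (S k) * RtoC (binomial_coef e (S k)))%C) y).
      split; [apply PS_has_der; auto|].
      assert (H1 := PS_euler _ y (G e) Hy). assert (H2 := binomial_euler e y Hy).
      set (d := PS (fun k => (INR (S k) * RtoC (binomial_coef e (S k)))%C) y) in *.
      destruct (Ceq_dec y 0) as [->|Hy0].
      - unfold d. rewrite PS_0 by (apply (geom_bounded_S _ (geom_bounded_INR _ (G e)))).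
        unfold binomial_series. rewrite PS_0 by auto. simpl.
        rewrite <- !RtoC_mult, <- RtoC_minus, <- RtoC_mult. f_equal. field.
      - rewrite <- H1 in H2.
        transitivity (/ y * ((1 - y) * (y * d)))%C; [field; exact Hy0|].
        rewrite H2. field. exact Hy0. }
    intros y Hy.
    assert (Hy1 : (1 - y)%C <> 0%C).
    { intros H. assert (y = 1%C) by (replace y with (1 - (1 - y))%C by ring; rewrite H; ring).
      subst y. rewrite Cmod_1 in Hy. lra. }
    destruct (D delta y Hy) as [d [Hd Ed]]. destruct (D (- delta) y Hy) as [e [He Ee]].
    replace (RtoC 0) with (d * binomial_series (- delta) y + binomial_series delta y * e)%C.
    - apply has_der_mult; assumption.
    - transitivity (/ (1 - y) * (((1 - y) * d) * binomial_series (- delta) y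
        + binomial_series delta y * ((1 - y) * e)))%C; [field; exact Hy1|].
      rewrite Ed, Ee, RtoC_opp. ring. }
  rewrite E0 in E. unfold binomial_series in E. rewrite !PS_0 in E by apply G.
  simpl in E.
  assert (E1 : (0 * PS (fun k : nat => binomial_coef (- delta) k) x)%C = 0%C) by ring.
  rewrite E1 in E. replace (1 * 1)%C with (RtoC 1) in E by ring.
  apply RtoC_inj in E. lra.
Qed.

(** * The extremal function *)

Definition shift_up (a : nat -> C) (k : nat) : C :=
  match k with O => 0%C | S j => a j end.

Lemma geom_bounded_shift_up (a : nat -> C) : geom_bounded a -> geom_bounded (shift_up a).
Proof.
  intros Ha rho Hr. destruct (geom_bounded_pos a rho Ha Hr) as [M [HM0 HM]].
  exists M. intros [|k]; simpl.
  - rewrite Cmod_0. lra.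
  - specialize (HM k). assert (0 <= Cmod (a k) * rho ^ k).
    { apply Rmult_le_pos; [apply Cmod_ge_0|apply pow_le; lra]. }
    nra.
Qed.

Lemma PS_shift_up (a : nat -> C) (x : C) : geom_bounded a -> Cmod x < 1 ->
  PS (shift_up a) x = (x * PS a x)%C.
Proof.
  intros Ha Hx. rewrite PS_step by auto using geom_bounded_shift_up.
  simpl. rewrite (PS_ext_coef (fun k => a k) a) by auto. ring.
Qed.

(** The coefficients, as a power series in [z], of the power series in [z^n]
    with coefficients [b]. *)
Definition spread (n : nat) (b : nat -> C) (k : nat) : C :=
  if Nat.eqb (k mod n) 0 then b (k / n)%nat else 0%C.

Lemma spread_small (n : nat) (b : nat -> C) (k : nat) :
  (k < n)%nat -> b 0%nat = 0%C -> spread n b k = 0%C.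
Proof.
  intros Hk Hb. unfold spread. rewrite Nat.mod_small, Nat.div_small by exact Hk.
  destruct (Nat.eqb k 0); [exact Hb|reflexivity].
Qed.

Lemma pow_lt_1 (r : R) (n : nat) : (1 <= n)%nat -> 0 <= r < 1 -> 0 <= r ^ n < 1.
Proof.
  intros Hn Hr. destruct n as [|m]; [lia|]. simpl.
  assert (0 <= r ^ m) by (apply pow_le; lra).
  assert (r ^ m <= 1) by (rewrite <- (pow1 m); apply pow_incr; lra). nra.
Qed.

Lemma Cmod_pow_lt_1 (z : C) (n : nat) : (1 <= n)%nat -> Cmod z < 1 -> Cmod (z ^ n) < 1.
Proof.
  intros Hn Hz. rewrite Cmod_pow. apply pow_lt_1; [exact Hn|].
  split; [apply Cmod_ge_0|exact Hz].
Qed.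

Lemma geom_bounded_spread (n : nat) (b : nat -> C) : (1 <= n)%nat ->
  geom_bounded b -> geom_bounded (spread n b).
Proof.
  intros Hn Hb rho Hr.
  assert (Hrn : 0 < rho ^ n < 1).
  { split; [apply pow_lt; lra|]. apply pow_lt_1; [exact Hn|lra]. }
  destruct (geom_bounded_pos b _ Hb Hrn) as [M [HM0 HM]].
  exists M. intros k. unfold spread. destruct (Nat.eqb_spec (k mod n) 0) as [E|_].
  - specialize (HM (k / n)%nat). rewrite <- pow_mult in HM.
    replace (n * (k / n))%nat with k in HM; [exact HM|].
    assert (H := Nat.div_mod_eq k n). lia.
  - rewrite Cmod_0. lra.
Qed.

Lemma Cpow_mult_exp (z : C) (n j : nat) : (z ^ (n * j) = (z ^ n) ^ j)%C.
Proof.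
  induction j as [|j IH].
  - rewrite Nat.mul_0_r. reflexivity.
  - rewrite Nat.mul_succ_r, Cpow_add_r, IH. simpl. ring.
Qed.

Lemma sum_spread (n : nat) (b : nat -> C) (z : C) (m : nat) : (1 <= n)%nat ->
  sum_n (fun k => (spread n b k * z ^ k)%C) m
  = sum_n (fun j => (b j * (z ^ n) ^ j)%C) (m / n).
Proof.
  intros Hn. induction m as [|m IH].
  - rewrite Nat.Div0.div_0_l, !sum_O. unfold spread.
    rewrite Nat.Div0.mod_0_l, Nat.Div0.div_0_l. reflexivity.
  - rewrite sum_Sn, IH. unfold spread.
    assert (H1 := Nat.div_mod_eq (S m) n). assert (H2 := Nat.div_mod_eq m n).
    assert (H3 := Nat.mod_upper_bound (S m) n ltac:(lia)).
    assert (H4 := Nat.mod_upper_bound m n ltac:(lia)).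
    destruct (Nat.eqb_spec (S m mod n) 0) as [E|E].
    + assert (Eq : (S m / n = S (m / n))%nat) by nia.
      rewrite Eq, sum_Sn. f_equal. rewrite <- Cpow_mult_exp. f_equal. f_equal. nia.
    + assert (Eq : (S m / n = m / n)%nat) by nia. rewrite Eq.
      change (sum_n (fun j => (b j * (z ^ n) ^ j)%C) (m / n) + 0 * z ^ S m
        = sum_n (fun j => (b j * (z ^ n) ^ j)%C) (m / n))%C. ring.
Qed.

Lemma PS_spread (n : nat) (b : nat -> C) (z : C) : (1 <= n)%nat ->
  geom_bounded b -> Cmod z < 1 -> PS (spread n b) z = PS b (z ^ n)%C.
Proof.
  intros Hn Hb Hz. symmetry.
  apply PS_unique; [apply geom_bounded_spread; assumption|exact Hz|].
  apply is_series_C_iff. intros eps He.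
  assert (H := PS_correct b (z ^ n)%C Hb (Cmod_pow_lt_1 z n Hn Hz)).
  destruct (proj1 (is_series_C_iff _ _) H eps He) as [N HN].
  exists (n * N)%nat. intros m Hm. rewrite sum_spread by exact Hn.
  apply HN. apply Nat.div_le_lower_bound; lia.
Qed.

Lemma smooth_analytic (F : C -> C) : smooth 2 F -> analytic_on_disk F.
Proof. intros H z Hz. apply taylor_ex_derive, H, Hz. Qed.

Lemma smooth_ext (m : nat) (F G : C -> C) :
  (forall z, Cmod z < 1 -> F z = G z) -> smooth m F -> smooth m G.
Proof.
  intros E H z Hz. apply (taylor_ext m F); [|apply H, Hz].
  generalize (near_disk 1 z Hz). apply near_mono. exact E.
Qed.

Lemma smooth_PS_pow (m n : nat) (u : nat -> C) : (1 <= n)%nat -> geom_bounded u ->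
  smooth m (fun z => PS u (z ^ n)%C).
Proof.
  intros Hn Hu. apply (smooth_ext m (PS (spread n u))).
  - intros z Hz. apply PS_spread; assumption.
  - intros z Hz. apply PS_taylor; [apply geom_bounded_spread; assumption|exact Hz].
Qed.

Lemma classA_PS_pow (n : nat) (u : nat -> C) : (1 <= n)%nat -> geom_bounded u ->
  u 0%nat = 1%C -> classA n (fun z => (z * PS u (z ^ n))%C).
Proof.
  intros Hn Hu Hu0. split.
  - apply smooth_analytic. intros z Hz. apply taylor_mult; [apply taylor_id|].
    apply (smooth_PS_pow 2 n u Hn Hu z Hz).
  - set (u' := shift_up (fun k => u (S k))).
    assert (Gu' : geom_bounded u') by apply geom_bounded_shift_up, geom_bounded_S, Hu.
    assert (Gs := geom_bounded_spread n u' Hn Gu').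
    exists (shift_up (spread n u')). split.
    + intros [|k] Hk; [reflexivity|]. apply spread_small; [lia|reflexivity].
    + intros z Hz.
      replace (z * PS u (z ^ n) - z)%C with (PS (shift_up (spread n u')) z).
      * apply PS_is_pseries; [apply geom_bounded_shift_up, Gs|exact Hz].
      * assert (Hzn := Cmod_pow_lt_1 z n Hn Hz).
        rewrite PS_shift_up, PS_spread by assumption. unfold u'.
        rewrite PS_shift_up, (PS_step u), Hu0 by auto using geom_bounded_S. ring.
Qed.

(** The extremal functions are [z (1 + s z^n) (1 - z^n)^(-delta)] with
    [s = 1] for the close-to-starlike one and [s = -1] for its starlike
    companion.  The exponent makes the quotient the Cayley transform of
    [z^n] and the logarithmic derivative of the companion the half-plane map
    of order [alpha]. *)
Definition extremal_exponent (n : nat) (alpha : R) : R :=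
  1 + 2 * (1 - alpha) / INR n.

Definition extremal_coef (s : C) (delta : R) (k : nat) : C :=
  (RtoC (binomial_coef delta k)
   + s * shift_up (fun k => RtoC (binomial_coef delta k)) k)%C.

Definition extremal (s : C) (n : nat) (alpha : R) (z : C) : C :=
  (z * PS (extremal_coef s (extremal_exponent n alpha)) (z ^ n))%C.

Lemma geom_bounded_extremal_coef (s : C) (delta : R) :
  geom_bounded (extremal_coef s delta).
Proof.
  apply geom_bounded_plus; [apply geom_bounded_binomial|].
  apply geom_bounded_scal, geom_bounded_shift_up, geom_bounded_binomial.
Qed.

Lemma PS_extremal_coef (s : C) (delta : R) (x : C) : Cmod x < 1 ->
  PS (extremal_coef s delta) x = ((1 + s * x) * binomial_series delta x)%C.
Proof.
  intros Hx. unfold extremal_coef, binomial_series.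
  assert (G := geom_bounded_binomial delta).
  rewrite (PS_add_coef (fun k => RtoC (binomial_coef delta k))
    (fun k => (s * shift_up (fun k => RtoC (binomial_coef delta k)) k)%C));
    auto using geom_bounded_scal, geom_bounded_shift_up.
  rewrite (PS_scal_coef s (shift_up (fun k => RtoC (binomial_coef delta k))));
    auto using geom_bounded_shift_up.
  rewrite PS_shift_up by auto. ring.
Qed.

Lemma extremal_eq (s : C) (n : nat) (alpha : R) (z : C) : (1 <= n)%nat -> Cmod z < 1 ->
  extremal s n alpha z
  = (z * ((1 + s * z ^ n) * binomial_series (extremal_exponent n alpha) (z ^ n)))%C.
Proof.
  intros Hn Hz. unfold extremal.
  rewrite PS_extremal_coef by (apply Cmod_pow_lt_1; assumption). reflexivity.
Qed.

Lemma extremal_classA (s : C) (n : nat) (alpha : R) : (1 <= n)%nat ->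
  classA n (extremal s n alpha).
Proof.
  intros Hn. apply classA_PS_pow; [exact Hn|apply geom_bounded_extremal_coef|].
  unfold extremal_coef. simpl. ring.
Qed.

Lemma one_minus_pow_neq_0 (n : nat) (z : C) : (1 <= n)%nat -> Cmod z < 1 ->
  (1 - z ^ n)%C <> 0%C.
Proof.
  intros Hn Hz H. assert (H1 := Cmod_pow_lt_1 z n Hn Hz).
  replace (z ^ n)%C with (1 - (1 - z ^ n))%C in H1 by ring. rewrite H in H1.
  replace (1 - 0)%C with (RtoC 1) in H1 by ring. rewrite Cmod_1 in H1. lra.
Qed.

Lemma binomial_series_pow_der (n : nat) (delta : R) (z : C) : (1 <= n)%nat -> Cmod z < 1 ->
  exists d, has_der (fun y => binomial_series delta (y ^ n)%C) z d /\
    ((1 - z ^ n) * (z * d) = INR n * delta * z ^ n * binomial_series delta (z ^ n))%C.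
Proof.
  intros Hn Hz. set (e := fun k => RtoC (binomial_coef delta k)).
  assert (G : geom_bounded e) by apply geom_bounded_binomial.
  assert (Gs := geom_bounded_spread n e Hn G).
  exists (PS (fun k => INR (S k) * spread n e (S k))%C z). split.
  - apply (has_der_ext (PS (spread n e))); [|apply PS_has_der; assumption].
    generalize (near_disk 1 z Hz). apply near_mono. intros y Hy.
    apply PS_spread; assumption.
  - rewrite PS_euler by assumption.
    rewrite (PS_ext_coef _ (fun k => (INR n * spread n (fun j => (INR j * e j)%C) k)%C)).
    + rewrite PS_scal_coef by auto using geom_bounded_spread, geom_bounded_INR.
      rewrite PS_spread by auto using geom_bounded_INR.
      assert (H := binomial_euler delta (z ^ n)%C (Cmod_pow_lt_1 z n Hn Hz)).
      fold e in H.
      transitivity (INR n * ((1 - z ^ n) * PS (fun j => INR j * e j)%C (z ^ n)))%C; [ring|].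
      unfold e. rewrite H. ring.
    + intros k. unfold spread. destruct (Nat.eqb_spec (k mod n) 0) as [E|_]; [|ring].
      replace (INR k) with (INR n * INR (k / n)).
      * rewrite RtoC_mult. ring.
      * rewrite <- mult_INR. f_equal. assert (H := Nat.div_mod_eq k n). lia.
Qed.

Lemma extremal_zlogder (s : C) (n : nat) (alpha : R) (z : C) :
  (1 <= n)%nat -> Cmod z < 1 -> z <> 0%C -> (1 + s * z ^ n)%C <> 0%C ->
  zlogder (extremal s n alpha) z =
  (1 + INR n * s * z ^ n / (1 + s * z ^ n)
   + INR n * extremal_exponent n alpha * z ^ n / (1 - z ^ n))%C.
Proof.
  intros Hn Hz Hz0 Hs.
  destruct (binomial_series_pow_der n (extremal_exponent n alpha) z Hn Hz) as [d [Hd Ed]].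
  set (B := fun y => binomial_series (extremal_exponent n alpha) (y ^ n)%C) in *.
  change (binomial_series (extremal_exponent n alpha) (z ^ n)%C) with (B z) in Ed.
  assert (HB : B z <> 0%C) by exact (binomial_series_neq_0 _ _ (Cmod_pow_lt_1 z n Hn Hz)).
  assert (H1 := one_minus_pow_neq_0 n z Hn Hz).
  set (d1 := (0 + (0 * z ^ n + s * (INR n * z ^ (n - 1) * 1)))%C).
  assert (D : has_der (extremal s n alpha) z
     (1 * ((1 + s * z ^ n) * B z) + z * (d1 * B z + (1 + s * z ^ n) * d))%C).
  { apply (has_der_ext (fun y => y * ((1 + s * y ^ n) * B y))%C).
    - generalize (near_disk 1 z Hz). apply near_mono. intros y Hy. symmetry.
      apply extremal_eq; assumption.
    - apply (has_der_mult (fun y => y) (fun y => ((1 + s * y ^ n) * B y)%C)); [apply has_der_id|].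
      apply (has_der_mult (fun y => (1 + s * y ^ n)%C) B); [|exact Hd].
      apply has_der_plus; [apply has_der_const|].
      apply (has_der_mult (fun _ => s) (fun y => (y ^ n)%C)); [apply has_der_const|].
      apply (has_der_pow (fun y => y)), has_der_id. }
  assert (Ed1 : (z * d1 = INR n * s * z ^ n)%C).
  { unfold d1. destruct n as [|m]; [lia|].
    replace (S m - 1)%nat with m by lia. simpl (z ^ S m)%C. ring. }
  assert (Ezd : (z * d = INR n * extremal_exponent n alpha * z ^ n * B z / (1 - z ^ n))%C).
  { rewrite <- Ed. field. exact H1. }
  unfold zlogder, one_at_0. destruct (Ceq_dec z 0) as [|_]; [contradiction|].
  rewrite (has_der_C_derive _ _ _ D), extremal_eq by assumption. fold (B z).
  transitivity (1 + z * d1 / (1 + s * z ^ n) + z * d / B z)%C.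
  - field. auto.
  - rewrite Ed1, Ezd. field. auto.
Qed.

Lemma extremal_exponent_eq (n : nat) (alpha : R) : (1 <= n)%nat ->
  INR n * extremal_exponent n alpha = INR n + 2 * (1 - alpha).
Proof.
  intros Hn. unfold extremal_exponent. field. apply not_0_INR. lia.
Qed.

Lemma extremal_starlike (n : nat) (alpha : R) : (1 <= n)%nat ->
  classST n alpha (extremal (- (1)) n alpha).
Proof.
  intros Hn.
  assert (H1 : forall z, Cmod z < 1 -> (1 + - (1) * z ^ n)%C <> 0%C).
  { intros z Hz. replace (1 + - (1) * z ^ n)%C with (1 - z ^ n)%C by ring.
    apply one_minus_pow_neq_0; assumption. }
  assert (Hlog : forall z, Cmod z < 1 -> zlogder (extremal (- (1)) n alpha) z =
    ((1 + RtoC (1 - 2 * alpha) * z ^ n) * / (1 - z ^ n))%C).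
  { intros z Hz. assert (H2 := one_minus_pow_neq_0 n z Hn Hz).
    destruct (Ceq_dec z 0) as [E|Hz0].
    - unfold zlogder, one_at_0. destruct (Ceq_dec z 0) as [_|]; [|contradiction].
      subst z. destruct n as [|m]; [lia|]. simpl.
      replace (1 - 0 * 0 ^ m)%C with (RtoC 1) by ring. field.
    - rewrite extremal_zlogder by auto.
      rewrite <- (RtoC_mult (INR n) (extremal_exponent n alpha)), extremal_exponent_eq by exact Hn.
      rewrite RtoC_plus, (RtoC_mult 2), !RtoC_minus, (RtoC_mult 2). field. exact H2. }
  split; [apply extremal_classA, Hn|]. split; [|split].
  - intros z Hz Hz0. rewrite extremal_eq by assumption.
    apply Cmult_neq_0; [exact Hz0|]. apply Cmult_neq_0; [apply H1, Hz|].
    apply binomial_series_neq_0, Cmod_pow_lt_1; assumption.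
  - apply smooth_analytic.
    apply (smooth_ext 2 (fun z => (1 + RtoC (1 - 2 * alpha) * z ^ n) * / (1 - z ^ n))%C).
    + intros z Hz. symmetry. apply Hlog, Hz.
    + intros z Hz. apply taylor_mult.
      * apply taylor_plus; [apply taylor_const|].
        apply taylor_mult; [apply taylor_const|apply taylor_pow, taylor_id].
      * apply (taylor_inv 1 (fun y => (1 - y ^ n)%C)).
        -- apply taylor_minus; [apply taylor_const|apply taylor_pow, taylor_id].
        -- apply one_minus_pow_neq_0; assumption.
  - exists (fun z => (z ^ n)%C). split; [|split].
    + apply smooth_analytic. intros z Hz. apply taylor_pow, taylor_id.
    + destruct n as [|m]; [lia|]. simpl. ring.
    + intros z Hz. split; [apply Cmod_pow_lt_1; assumption|]. apply Hlog, Hz.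
Qed.

Lemma extremal_classCS (n : nat) (alpha : R) : (1 <= n)%nat ->
  classCS n alpha (extremal 1 n alpha).
Proof.
  intros Hn. split; [apply extremal_classA, Hn|].
  exists (extremal (- (1)) n alpha). split; [apply extremal_starlike, Hn|].
  set (two := fun _ : nat => RtoC 2).
  assert (G2 : geom_bounded two).
  { intros rho Hr. exists 2. intros k. unfold two. rewrite Cmod_R, Rabs_pos_eq by lra.
    assert (rho ^ k <= 1) by (rewrite <- (pow1 k); apply pow_incr; lra). lra. }
  assert (Gc := geom_bounded_spread n _ Hn (geom_bounded_shift_up two G2)).
  assert (Hp : forall z, Cmod z < 1 ->
    one_at_0 (fun z => (extremal 1 n alpha z / extremal (- (1)) n alpha z)%C) z
      = ((1 + z ^ n) * / (1 - z ^ n))%C).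
  { intros z Hz. assert (H1 := one_minus_pow_neq_0 n z Hn Hz).
    unfold one_at_0. destruct (Ceq_dec z 0) as [->|Hz0].
    - destruct n as [|m]; [lia|]. simpl.
      replace (1 - 0 * 0 ^ m)%C with (RtoC 1) by ring. field.
    - rewrite !extremal_eq by assumption.
      assert (HB := binomial_series_neq_0 (extremal_exponent n alpha) (z ^ n)%C
        (Cmod_pow_lt_1 z n Hn Hz)).
      field. repeat split; assumption. }
  assert (Hs : forall z, Cmod z < 1 ->
    ((1 + z ^ n) * / (1 - z ^ n) - 1)%C = PS (spread n (shift_up two)) z).
  { intros z Hz. assert (H1 := one_minus_pow_neq_0 n z Hn Hz).
    assert (Hzn := Cmod_pow_lt_1 z n Hn Hz).
    rewrite PS_spread, PS_shift_up by auto using geom_bounded_shift_up.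
    assert (E := PS_step two (z ^ n)%C G2 Hzn).
    change (fun k => two (S k)) with two in E. unfold two at 2 in E.
    replace (PS two (z ^ n)%C) with (2 / (1 - z ^ n))%C.
    - field. exact H1.
    - transitivity ((PS two (z ^ n) - z ^ n * PS two (z ^ n)) / (1 - z ^ n))%C.
      + rewrite E at 1. field. exact H1.
      + field. exact H1. }
  split; [|split].
  - apply smooth_analytic.
    apply (smooth_ext 2 (fun z => (1 + z ^ n) * / (1 - z ^ n))%C).
    + intros z Hz. symmetry. apply Hp, Hz.
    + intros z Hz. apply taylor_mult.
      * apply taylor_plus; [apply taylor_const|apply taylor_pow, taylor_id].
      * apply (taylor_inv 1 (fun y => (1 - y ^ n)%C)).
        -- apply taylor_minus; [apply taylor_const|apply taylor_pow, taylor_id].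
        -- apply one_minus_pow_neq_0; assumption.
  - exists (spread n (shift_up two)). split.
    + intros k Hk. apply spread_small; [exact Hk|reflexivity].
    + intros z Hz. rewrite Hp, Hs by exact Hz. apply PS_is_pseries; assumption.
  - intros z Hz. rewrite Hp by exact Hz.
    assert (H1 := one_minus_pow_neq_0 n z Hn Hz).
    assert (Hzn := Cmod_pow_lt_1 z n Hn Hz). set (x := (z ^ n)%C) in *.
    assert (E := Cmod_minus_plus_1 ((1 + x) * / (1 - x))%C).
    replace ((1 + x) * / (1 - x) + 1)%C with (2 * / (1 - x))%C in E by (field; exact H1).
    replace ((1 + x) * / (1 - x) - 1)%C with (2 * x * / (1 - x))%C in E by (field; exact H1).
    rewrite !Cmod_mult, Cmod_R, Rabs_pos_eq in E by lra.
    assert (H3 : 0 < Cmod (/ (1 - x))).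
    { rewrite Cmod_inv by exact H1. apply Rinv_0_lt_compat, Cmod_gt_0, H1. }
    set (q := Cmod (/ (1 - x))) in *. assert (H0 := Cmod_ge_0 x).
    assert (0 < q ^ 2 * (1 - Cmod x ^ 2)).
    { apply Rmult_lt_0_compat; [apply pow_lt, H3|nra]. }
    lra.
Qed.

(** At a positive [z] both factors of the extremal function reach their
    bounds simultaneously. *)
Lemma extremal_attains_majorant (n : nat) (alpha r : R) :
  (1 <= n)%nat -> 0 < r < 1 ->
  Re (zlogder (extremal 1 n alpha) (RtoC r)) = CS_majorant n alpha (r ^ n).
Proof.
  intros Hn Hr.
  assert (Hrn := pow_lt_1 r n Hn (conj (Rlt_le _ _ (proj1 Hr)) (proj2 Hr))).
  rewrite extremal_zlogder; [|exact Hn| | |].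
  - rewrite Cmult_1_l, Cmult_1_r, <- RtoC_pow, <- !RtoC_mult, extremal_exponent_eq by exact Hn.
    rewrite <- RtoC_minus, <- !RtoC_plus, <- !RtoC_div, <- !RtoC_plus by lra.
    change (Re (RtoC ?x)) with x. simpl. unfold CS_majorant. field. split; nra.
  - rewrite Cmod_R, Rabs_pos_eq; lra.
  - intros H. apply RtoC_inj in H. lra.
  - rewrite Cmult_1_l, <- RtoC_pow, <- RtoC_plus. intros H. apply RtoC_inj in H. lra.
Qed.

Theorem theorem3p2 (n : nat) (alpha beta : R) (hn : (1 <= n)%nat)
  (halpha : 0 <= alpha < 1) (hbeta : 1 < beta) :
  is_M_radius beta (classCS n alpha)
    (Rpower
       ((beta - 1) /
        ((1 + INR n - alpha) +
         sqrt ((1 + INR n - alpha) ^ 2 + (beta - 1) * (1 + beta - 2 * alpha))))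
       (/ INR n)).
Proof.
  fold (critical_rho n alpha beta).
  destruct (critical_rho_root n alpha beta halpha hbeta) as [Hrho _].
  destruct (Rpower_root_pow n (critical_rho n alpha beta) hn Hrho) as [Hpow HR].
  set (R0 := Rpower (critical_rho n alpha beta) (/ INR n)) in *.
  split.
  - split; [lra|]. intros f Hf r Hr. split.
    + intros z Hz. apply (close_to_starlike_nonvanishing n alpha f Hf). lra.
    + intros z Hz. destruct (Ceq_dec z 0) as [Hz0|Hz0].
      * unfold zlogder, one_at_0. destruct (Ceq_dec z 0); [|contradiction]. simpl. lra.
      * eapply Rle_lt_trans.
        -- apply (close_to_starlike_estimate n alpha f z hn); [lra|exact Hf|lra|exact Hz0].
        -- assert (H0 := Cmod_ge_0 z). apply CS_majorant_lt; [exact halpha|exact hbeta|].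
           split; [apply pow_le, H0|]. rewrite <- Hpow.
           apply pow_lt_compat; [exact hn|lra].
  - intros rho' [Hrho' Hadm]. apply Rnot_lt_le. intros Hlt.
    destruct (Hadm _ (extremal_classCS n alpha hn) ((R0 + rho') / 2) ltac:(lra)) as [_ H].
    specialize (H (RtoC R0)). rewrite Cmod_R, Rabs_pos_eq in H by lra.
    specialize (H ltac:(lra)).
    rewrite extremal_attains_majorant, Hpow, CS_majorant_critical in H by assumption. lra.
Qed.
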